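(* Let $D_1=\{(t,s,x)\in[0,T]\times[0,T]\times\mathbb{R} : 0\le s\le t\}$ and $D_2=\{(t,s,x)\in[0,T]\times[0,\mathcal{S}]\times\mathbb{R} : 0\le s\le t\}$, with topological boundaries $\partial D_1,\partial D_2$ in $\mathbb{R}^3$. For $j\in\{1,2\}$ let $\underline{v}_j:D_j\to\mathbb{R}$ and $\overline{v}_j:D_j\to\mathbb{R}$ be Lipschitz continuous functions such that $(\underline{v}_1,\underline{v}_2)$ is a viscosity subsolution and $(\overline{v}_1,\overline{v}_2)$ is a viscosity supersolution (in the sense given in the context) of the system $$\sup_{b\ge 0}\mathcal{A}^b v_1(t,s,x)=0,\qquad t\in[0,T),\ s\in[0,t],\ x\in\mathbb{R},$$ $$\sup_{b\ge 0}\mathcal{A}^b v_2(t,s,x)=0,\qquad t\in[0,T),\ s\in[0,t]\text{ and } s<\mathcal{S},\ x\in\mathbb{R},$$ where, for $i\in\{1,2\}$, $$\mathcal{A}^b v_i(t,s,x)=\Big(\tfrac{\partial}{\partial t}+\tfrac{\partial}{\partial s}\Big)v_i(t,s,x)+(c-\pi_i(s,m_i))\tfrac{\partial}{\partial x}v_i(t,s,x)+\lambda\int_0^b v_i(t,s,x-y)\,dF_Y(y)+\lambda\int_b^\infty v_2(t,0,x-r(y,m_i))\,dF_Y(y)-\lambda v_i(t,s,x).$$ If $\underline{v}_j\le\overline{v}_j$ on $\partial D_j$ for $j\in\{1,2\}$, then $\underline{v}_j\le\overline{v}_j$ on $D_j$ for $j\in\{1,2\}$.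
   Context: Data. $T>0$, $\mathcal{S}>0$, $\lambda>0$, $m_1,m_2\ge0$, and $r(y,m)=\min(y,m)$. $F_Y$ is the continuous distribution function of a random variable $Y$ with $F_Y(0)=0$ and $\mathbb{E}[Y^2]<\infty$. The premium rates $\pi_1(s,m_1),\pi_2(s,m_2)$ are nonnegative measurable functions of $s\ge0$ (and of the deductible), with $\pi_1<\pi_2$, and the constant income rate $c$ is larger than the premium rates, $\pi_i<c$. Viscosity sub- and supersolutions. Let $(v_1,v_2)$ be a pair of continuous functions $v_j:D_j\to\mathbb{R}$ of at most linear growth in $x$. An admissible test pair is a pair $(\varphi_1,\varphi_2)$ of functions $\varphi_j:D_j\to\mathbb{R}$ that are restrictions of continuously differentiable functions on $\mathbb{R}^3$ and have at most quadratic growth in $x$ (uniformly in $(t,s)$). The pair $(v_1,v_2)$ is a viscosity supersolution if for each $i$, each point $(t,s,x)\in D_i$ with $t<T$ (and $s<\mathcal{S}$ if $i=2$), and each test pair with $\varphi_j\le v_j$ on $D_j$ for $j=1,2$ and $\varphi_i(t,s,x)=v_i(t,s,x)$, one has $\sup_{b\ge0}\mathcal{A}^b\varphi_i(t,s,x)\le0$. It is a viscosity subsolution if for each such $i$ and point, and each test pair $(\psi_1,\psi_2)$ with $\psi_j\ge v_j$ on $D_j$ for $j=1,2$ and $\psi_i(t,s,x)=v_i(t,s,x)$, one has $\sup_{b\ge0}\mathcal{A}^b\psi_i(t,s,x)\ge0$. (Here $\mathcal{A}^b\varphi_1$ involves $\varphi_2$ in the second integral.) *)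

(* Defs.v *)
From HB Require Import structures.
From mathcomp Require Import all_boot all_order all_algebra.
From mathcomp Require Import all_classical all_reals all_analysis.

Set Implicit Arguments.
Unset Strict Implicit.
Unset Printing Implicit Defensive.

Import Order.TTheory GRing.Theory Num.Theory.
Import numFieldNormedType.Exports.

Local Open Scope classical_set_scope.
Local Open Scope ring_scope.

(* The index set {1, 2} of the coupled system. *)
Inductive regime := regime1 | regime2.

(* Points of R^3 are triples (t, s, x); the norm of R * R * R is the max norm. *)
Definition point3 (R : realType) : normedModType R := (R * R * R)%type.

Definition boundary (X : topologicalType) (A : set X) : set X :=
  closure A `\` A°.

Section System.
Context {R : realType}.
Implicit Types (T S lam c b : R) (nu : probability R R) (i j : regime).
Implicit Types (pi : regime -> R -> R -> R) (m : regime -> R).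
(* The functions v_j on D_j are represented by total functions on R^3 of which
   only the values on D_j matter; a test function is represented by a C^1
   extension to R^3. *)
Implicit Types (v phi : regime -> point3 R -> R) (f : point3 R -> R).

Definition s_bound T S i : R := match i with regime1 => T | regime2 => S end.

Definition Dom T S i : set (point3 R) :=
  [set z | let: (t, s, _) := z in
     [/\ 0 <= t <= T, 0 <= s <= s_bound T S i & 0 <= s <= t]].

(* The points at which the equation with index i is imposed. *)
Definition active T S i : set (point3 R) :=
  [set z | let: (t, s, _) := z in
     [/\ Dom T S i z, t < T & i = regime2 -> s < S]].

Definition e_t : point3 R := (1, 0, 0).
Definition e_s : point3 R := (0, 1, 0).
Definition e_x : point3 R := (0, 0, 1).

Definition retention (y d : R) : R := Num.min y d.

(* [nu] is the law of Y, so that integration against it is dF_Y; for a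
   continuous F_Y the endpoints 0 and b carry no mass. *)
Definition generator nu lam c pi m b phi i (z : point3 R) : R :=
  let: (t, s, x) := z in
  'D_e_t (phi i) z + 'D_e_s (phi i) z + (c - pi i s (m i)) * 'D_e_x (phi i) z
  + lam * (\int[nu]_(y in `]0%R, b]) phi i (t, s, x - y))
  + lam * (\int[nu]_(y in `]b, +oo[) phi regime2 (t, 0%R, x - retention y (m i)))
  - lam * phi i z.

(* sup over b >= 0, taken in the extended reals. *)
Definition sup_generator nu lam c pi m phi i (z : point3 R) : \bar R :=
  ereal_sup [set (generator nu lam c pi m b phi i z)%:E | b in [set b | 0 <= b]].

Definition C1 f : Prop :=
  forall e, [\/ e = e_t, e = e_s | e = e_x] ->
    (forall z, derivable f z e) /\ continuous (fun z => 'D_e f z).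

Definition linear_growth (A : set (point3 R)) f : Prop :=
  exists K : R, forall t s x, A (t, s, x) -> `|f (t, s, x)| <= K * (1 + `|x|).

Definition quadratic_growth (A : set (point3 R)) f : Prop :=
  exists K : R, forall t s x, A (t, s, x) -> `|f (t, s, x)| <= K * (1 + x ^+ 2).

Definition test_pair T S phi : Prop :=
  forall j, C1 (phi j) /\ quadratic_growth (Dom T S j) (phi j).

Definition viscosity_class T S v : Prop :=
  forall j, {within Dom T S j, continuous (v j)} /\
            linear_growth (Dom T S j) (v j).

Definition viscosity_supersolution T S nu lam c pi m v : Prop :=
  viscosity_class T S v /\
  forall i z phi, active T S i z -> test_pair T S phi ->
    (forall j w, Dom T S j w -> phi j w <= v j w) -> phi i z = v i z ->
    (sup_generator nu lam c pi m phi i z <= 0)%E.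

Definition viscosity_subsolution T S nu lam c pi m v : Prop :=
  viscosity_class T S v /\
  forall i z psi, active T S i z -> test_pair T S psi ->
    (forall j w, Dom T S j w -> v j w <= psi j w) -> psi i z = v i z ->
    (0 <= sup_generator nu lam c pi m psi i z)%E.

End System.

(* Main.v *)
(* Points with s = 0 lie on the boundary, so the coupling term v_2(t, 0, .) is
   already ordered and each index can be treated on its own.  As pi_i is only
   measurable in s, doubling the variable s is not possible.  Instead, put
   xi' = c - pi_i almost everywhere, fix a characteristic
   s |-> (k + s, s, xi s) and regularize only in (t, x):
     U(s) = sup_(t,x) u(t, s, x) - ((t - k - s)^2 + (x - xi s)^2) / eps.
   U is Lipschitz, hence differentiable almost everywhere, and where both U and
   xi are differentiable at s the maximizer (t, s, x) is a point at which u has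
   a first-order expansion from above whose derivative along (1, 1, xi' s) is
   U'(s).  There the viscosity inequality can be tested at exactly this s.  The
   same applies to V built from -v.  Writing M for the supremum of u - v and 0,
   subtracting the two inequalities for the same b gives
     (U + V)' >= lam (U + V - M) - O(eps)  almost everywhere,
   so exp(- lam s) (u - v - M) is nondecreasing along characteristics, which
   leave the domain through the boundary; thus u - v <= (1 - exp(- lam T)) M
   everywhere, that is M = 0. *)
Require Import Defs.
From HB Require Import structures.
From mathcomp Require Import all_boot all_order all_algebra.
From mathcomp Require Import all_classical all_reals all_analysis.
From mathcomp Require Import measurable_realfun ring lra.

Import Order.TTheory GRing.Theory Num.Theory.
Import numFieldNormedType.Exports.

Local Open Scope classical_set_scope.
Local Open Scope ring_scope.

(** * Lipschitz functions of one real variable *)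

(** The generator is nonlocal: at (t, s, x) it integrates test functions along the whole lines (t,
    s, .) and (t, 0, .). Touching from above is therefore not enough; a test function must also stay
    within eta of the function that it majorizes on both lines, so that the integrals can be
    estimated through u and v themselves. Producing such C^1 functions from a mere first-order
    expansion takes up a large part of the proof. The domain is unbounded in x, but no maximum of u
    - v is ever sought. Only the sup-convolution is maximized, and there Lipschitz continuity
    confines the maximizers to a distance O(eps) from the characteristic; M only has to be finite,
    which follows from the ordering at s = 0 and Lipschitz continuity in s. The maximizers behind U
    s and V s share s but may differ in t and x by O(eps). This is harmless because no coefficient
    of the equation depends on t or x. *)

Definition lip {R : realType} (L : R) (f : R -> R) :=
  forall x y, `|f x - f y| <= L * `|x - y|.

Lemma lip_continuous (R : realType) (L : R) (f : R -> R) :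
  lip L f -> continuous f.
Proof.
move=> fL x; apply/cvgrPdist_le => /= e e0.
have M0 : 0 < `|L| + 1 by rewrite ltr_wpDl.
near=> y.
apply: (le_trans (fL _ _)).
apply: (@le_trans _ _ ((`|L| + 1) * `|x - y|)).
  by rewrite ler_wpM2r// (le_trans (ler_norm _))// lerDl.
rewrite -ler_pdivlMl//.
near: y; have d0 : 0 < (`|L| + 1)^-1 * e by rewrite mulr_gt0// invr_gt0.
by have := nbhsx_ballx x _ d0; apply: filterS => y /ltW.
Unshelve. all: by end_near. Qed.

(** Both sides are infima over the same covers by half-open intervals, so lengths need only be
    compared interval by interval. This yields the absolute continuity required by Radon-Nikodym. *)
Lemma wlength_le_lebesgue (R : realType) (G : cumulative R R) (K : R)
    (K0 : 0 < K) (GK : forall x y, x <= y -> G y - G x <= K * (y - x))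
    (A : set R) :
  (lebesgue_stieltjes_measure G A <= K%:E * lebesgue_measure A)%E.
Proof.
rewrite muleC -lee_pdivrMr//.
rewrite /lebesgue_measure /lebesgue_stieltjes_measure /measure_extension /=.
apply: le_ereal_inf_tmp => _ [B [mB AB] <-].
rewrite lee_pdivrMr// muleC.
rewrite -nneseriesZl//.
apply: (@le_trans _ _ (\sum_(k <oo) wlength G (B k))%E).
  by apply: ereal_inf_lbound; exists B.
apply: lee_nneseries => [i _|i _]; first by rewrite measure_ge0.
have [[a b] _ <-] := mB i.
rewrite !wlength_itv/= !lte_fin; case: ifPn => [ab|_]; last by rewrite mule0.
by rewrite -!EFinB -EFinM lee_fin GK// ltW.
Qed.

(* Radon-Nikodym applied to the Lebesgue-Stieltjes measure of [g]. *)
Lemma nondecreasing_lip_density (R : realType) (K : R) (g : R -> R) (a b : R) :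
  0 < K -> nondecreasing g -> lip K g ->
  exists f : R -> R, [/\ lebesgue_measure.-integrable setT (EFin \o f) &
    forall x, a <= x <= b -> g x - g a = (\int[lebesgue_measure]_(t in `[a, x]) f t)%R].
Proof.
move=> K0 gnd gL.
pose gm := isCumulative.Build R _ R g gnd (right_continuousW (lip_continuous _ _ _ gL)).
pose G : cumulative R R := HB.pack g gm.
have GK x y : x <= y -> G y - G x <= K * (y - x).
  move=> xy; rewrite (le_trans (ler_norm _))// (le_trans (gL _ _))//.
  by rewrite ger0_norm// subr_ge0.
(* Restricting to []a, b]] makes the measure finite and keeps its value [g x - g a] on []a, x]] for
   [x] in [[a, b]]. *)
pose D : set R := [set` `]a, b]].
have mD : measurable (D : set (measurableTypeR R)) by exact: measurable_itv.
have nuD : (lebesgue_stieltjes_measure G D < +oo)%E.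
  apply: (le_lt_trans (wlength_le_lebesgue _ _ _ K0 GK D)).
  by rewrite lebesgue_measure_itv/=; case: ifPn => _; rewrite ?mule0 ?ltry// -EFinB -EFinM ltry.
pose nu : {finite_measure set _ -> \bar R} := mfrestr mD nuD.
have dom : nu `<< (@lebesgue_measure R).
  apply/null_content_dominatesP => A mA A0.
  apply/eqP; rewrite eq_le measure_ge0 andbT.
  rewrite /nu /= /mfrestr /mrestr.
  apply: (@le_trans _ _ (lebesgue_stieltjes_measure G A)).
    by apply: le_measure; rewrite ?inE//; exact: measurableI.
  by rewrite (le_trans (wlength_le_lebesgue _ _ _ K0 GK A))// A0 mule0.
have [f [f0 ffin fint fE]] := radon_nikodym_sigma_finite dom.
pose h : R -> R := fine \o f.
have ff : EFin \o h = f by apply/funext => x /=; rewrite fineK.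
have hint : lebesgue_measure.-integrable setT (EFin \o h) by rewrite ff.
have hE (A : set R) : measurable A -> nu A = (\int[lebesgue_measure]_(t in A) (h t)%:E)%E.
  by move=> mA; rewrite fE// -ff.
exists h; split => // x /andP[ax xb].
have mh : measurable_fun setT h by apply/measurable_EFinP; case/integrableP : hint.
rewrite /Rintegral -integral_itv_obnd_cbnd//; last first.
  by apply: measurable_funTS; exact/measurable_EFinP.
rewrite -hE; last exact: measurable_itv.
rewrite /nu /= /mfrestr /mrestr setIidl; last first.
  by apply: subset_itvl; rewrite bnd_simp.
rewrite /lebesgue_stieltjes_measure /measure_extension measurable_mu_extE/=; last exact: is_ocitv.
by rewrite wlength_itv_bnd.
Qed.

(** At a Lebesgue point of the density the primitive is differentiable, and near an interior point
    [g] is this primitive plus the constant [g a]. The integral formula is kept because the sign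
    argument of [lip_ae_derive_ge0] integrates the derivative. *)
Lemma nondecreasing_lip_ae_derive (R : realType) (K : R) (g : R -> R) (a b : R) :
  0 < K -> nondecreasing g -> lip K g ->
  exists f : R -> R, [/\ lebesgue_measure.-integrable setT (EFin \o f),
    forall x, a <= x <= b ->
      g x - g a = (\int[lebesgue_measure]_(t in `[a, x]) f t)%R &
    {ae lebesgue_measure, forall x, a < x < b -> is_derive x 1 g (f x)}].
Proof.
move=> K0 gnd gL; have [f [fint fE]] := nondecreasing_lip_density R K g a b K0 gnd gL.
exists f; split => //.
have := lebesgue_differentiation (open_integrable_locally openT fint).
apply: filterS; first exact: (ae_filter_ringOfSetsType lebesgue_measure).
move=> x fx /andP[ax xb].
have fint' : lebesgue_measure.-integrable [set` Interval (BLeft a) (BRight b)] (EFin \o f).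
  by apply: integrableS fint => //; exact: measurable_itv.
have ax' : (BLeft a < BRight x)%E by rewrite lte_fin.
have [dF DF] := FTC1_lebesgue_pt xb fint' ax' fx.
rewrite derive1E in DF.
have dG : is_derive x 1 (fun y => \int[lebesgue_measure]_(t in `[a, y]) f t + g a)%R (f x).
  rewrite -[X in is_derive _ _ _ X]addr0.
  by apply: is_deriveD; apply: DeriveDef.
apply: near_eq_is_derive dG.
have xab : x \in `]a, b[ by rewrite in_itv/= ax.
apply: filterS (near_in_itvoo xab) => y; rewrite in_itv/= => /andP[ay yb].
by rewrite -fE ?subrK// !ltW.
Qed.

Lemma lip_ge0 (R : realType) (L : R) (f : R -> R) : lip L f -> 0 <= L.
Proof. by move=> /(_ 1 0); rewrite subr0 normr1 mulr1; exact: le_trans. Qed.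

(** The slope [L + 1] exceeds [L] so that the new Lipschitz constant is positive even for [L = 0],
    as the density lemmas require. *)
Lemma lip_addK_nondecreasing (R : realType) (L : R) (F : R -> R) (fL : lip L F) :
  nondecreasing (fun x => F x + (L + 1) * x) /\
  lip (L + (L + 1)) (fun x => F x + (L + 1) * x).
Proof.
have L0 := lip_ge0 _ _ _ fL.
split=> x y.
  move=> xy; have := fL x y; rewrite ler_norml => /andP[_].
  by rewrite ler0_norm ?subr_le0//; nra.
rewrite [X in `|X|](_ : _ = (F x - F y) + (L + 1) * (x - y)); last by ring.
rewrite (le_trans (ler_normD _ _))// normrM (ger0_norm (addr_ge0 L0 _))//.
by have := fL x y; lra.
Qed.

(** Rademacher's theorem in dimension one, reduced to the monotone case by adding a linear
    function. *)
Lemma lip_ae_derivable (R : realType) (L : R) (F : R -> R) (a b : R) :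
  lip L F ->
  {ae lebesgue_measure, forall x : R, a < x < b -> derivable F x 1}.
Proof.
move=> fL; have [gnd gL] := lip_addK_nondecreasing _ _ _ fL.
have L0 := lip_ge0 _ _ _ fL.
have K0 : 0 < L + (L + 1) by lra.
have [f [_ _]] := nondecreasing_lip_ae_derive _ _ _ a b K0 gnd gL.
apply: filterS; first exact: (ae_filter_ringOfSetsType lebesgue_measure).
move=> x fx /fx dg.
rewrite (_ : F = (fun x => F x + (L + 1) * x) - (fun x => (L + 1) * x)); last first.
  by apply/funext => y; rewrite !fctE/=; ring.
by apply: derivableB; [exact: ex_derive|exact: derivableM].
Qed.

(** Absolute continuity is essential (minus the Cantor function has zero derivative almost
    everywhere): the density of [F x + (L + 1) * x] is at least [L + 1] almost everywhere, and
    integrating it over [[a, b]] leaves [F b - F a >= 0]. *)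
Lemma lip_ae_derive_ge0 (R : realType) (L : R) (F : R -> R) (a b : R) :
  lip L F -> a <= b ->
  {ae lebesgue_measure, forall x : R, a < x < b -> derivable F x 1 -> 0 <= 'D_1 F x} ->
  F a <= F b.
Proof.
move=> fL ab aeF; have [gnd gL] := lip_addK_nondecreasing _ _ _ fL.
have L0 := lip_ge0 _ _ _ fL.
have K0 : 0 < L + (L + 1) by lra.
have [f [fint fE fd]] := nondecreasing_lip_ae_derive _ _ _ a b K0 gnd gL.
have aef : {ae lebesgue_measure, forall x : R, a < x < b -> L + 1 <= f x}.
  have := aeF; apply: filterS2 fd; first exact: (ae_filter_ringOfSetsType lebesgue_measure).
  move=> x dg dF xab; have {}dg := dg xab.
  have dFx : is_derive x 1 F (f x - (L + 1)).
    rewrite (_ : F = (fun x => F x + (L + 1) * x) - (fun x => (L + 1) * x)); last first.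
      by apply/funext => y; rewrite !fctE/=; ring.
    apply: is_deriveB => //.
    by apply: is_derive_eq; rewrite /GRing.scale/=; ring.
  have := dF xab (@ex_derive _ _ _ _ _ _ _ dFx).
  by rewrite derive_val subr_ge0.
have := fE b; rewrite ab lexx => /(_ isT).
suff : (L + 1) * (b - a) <= \int[lebesgue_measure]_(t in `[a, b]) f t by lra.
rewrite [leLHS](_ : _ = \int[lebesgue_measure]_(t in `[a, b]) (cst (L + 1)) t); last first.
  rewrite Rintegral_cst//= lebesgue_measure_itv/= lte_fin; case: ltP => //= ba.
  by have -> : a = b by [apply/eqP; rewrite eq_le ab]; rewrite subrr !mulr0.
have mf D : measurable_fun D f.
  by apply: measurable_funTS; apply/measurable_EFinP; case/integrableP : fint.
have intf (D : set R) : measurable D -> lebesgue_measure.-integrable D (EFin \o f).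
  by move=> mD; exact: integrableS fint.
have intc (i : interval R) : (lebesgue_measure [set` i] < +oo)%E ->
    lebesgue_measure.-integrable [set` i] (EFin \o cst (L + 1)).
  move=> ioo; apply/integrableP; split; first exact/measurable_EFinP/measurable_cst.
  by rewrite /= integral_cst// lte_mul_pinfty.
have fini b0 b1 : (lebesgue_measure [set` Interval (BSide b0 a) (BSide b1 b)] < +oo)%E.
  by rewrite lebesgue_measure_itv/=; case: ifPn => _; rewrite ?ltry// -EFinB ltry.
(* The lower bound on the density is known on the open interval only, so the endpoints are removed
   from both integrals. *)
have ooE (h : R -> R) : (forall b0 b1, lebesgue_measure.-integrable
    [set` Interval (BSide b0 a) (BSide b1 b)] (EFin \o h)) ->
    \int[lebesgue_measure]_(t in `[a, b]) h t = \int[lebesgue_measure]_(t in `]a, b[) h t.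
  move=> ih; rewrite -Rintegral_itv_bndo_bndc; last exact: ih.
  by rewrite -Rintegral_itv_obnd_cbnd//; exact: ih.
rewrite (ooE f); last by move=> b0 b1; exact: intf.
rewrite (ooE (cst (L + 1))); last by move=> b0 b1; apply: intc; exact: fini.
(* Truncation from below turns the almost everywhere bound into a pointwise one without changing the
   integral. *)
pose h x := Num.max (f x) (L + 1).
have mh : measurable_fun setT h by apply: measurable_maxr => //; exact: mf.
have fh : ae_eq lebesgue_measure [set` `]a, b[] (EFin \o f) (EFin \o h).
  apply: filterS aef; first exact: (ae_filter_ringOfSetsType lebesgue_measure).
  by move=> x fx; rewrite /= in_itv/= => /fx Lf; rewrite /h max_l.
have -> : \int[lebesgue_measure]_(t in `]a, b[) f t =
          \int[lebesgue_measure]_(t in `]a, b[) h t.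
  rewrite /Rintegral; congr fine; apply: ae_eq_integral => //.
  - by apply/measurable_EFinP; exact: mf.
  - by apply/measurable_EFinP; apply: measurable_funTS.
apply: le_Rintegral => //.
- exact: intc.
- have ig : lebesgue_measure.-integrable [set` `]a, b[] (fun x => `|(f x)%:E| + (L + 1)%:E)%E.
    apply: integrableD => //; last exact: intc.
    by apply: integrable_abse; exact: intf.
  apply: le_integrable ig => //.
  + by apply/measurable_EFinP; apply: measurable_funTS.
  + move=> x _ /=; rewrite lee_fin [leRHS]ger0_norm ?addr_ge0// /h.
    case: (leP (f x) (L + 1)) => _; last by rewrite lerDl addr_ge0.
    by rewrite ger0_norm ?addr_ge0// lerDr.
- by move=> x _; rewrite /h le_max lexx orbT.
Qed.

Lemma primitive_lebesgue_pt (R : realType) (f : R -> R) :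
  (forall x y, lebesgue_measure.-integrable [set` `[x, y]] (EFin \o f)) ->
  exists F : R -> R, (forall x y, x <= y ->
      F y - F x = (\int[lebesgue_measure]_(t in `[x, y]) f t)%R) /\
    forall x : R, lebesgue_pt f x -> is_derive x 1 F (f x).
Proof.
move=> intf.
pose I x y := (\int[lebesgue_measure]_(t in `[x, y]) f t)%R.
have Iadd x y z : x <= y -> y <= z -> I x z = I x y + I y z.
  move=> xy yz; have := @Rintegral_itvB _ f (BLeft x) (BRight z) y (intf x z).
  rewrite !bnd_simp => /(_ xy yz) E.
  rewrite [I y z]/I -Rintegral_itv_obnd_cbnd; last first.
    by apply: integrableS (intf y z) => //; exact: subset_itv_oc_cc.
  by rewrite -E/= /I; ring.
(* Oriented integration from 0 gives a single primitive on the whole line. *)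
pose F x := if 0 <= x then I 0 x else - I x 0.
have FI x y : x <= y -> F y - F x = I x y.
  move=> xy; rewrite /F; case: (leP 0 x) => x0.
    by rewrite (le_trans x0 xy) (Iadd 0 x y)//; ring.
  case: (leP 0 y) => y0; first by rewrite (Iadd x 0 y)// ?ltW//; ring.
  by rewrite (Iadd x y 0)// ?ltW//; ring.
exists F; split => // x fx.
have xlt : x < x + 1 by rewrite ltrDl.
have ax : (BLeft (x - 1)%R < BRight x)%E by rewrite lte_fin ltrBlDr.
have [dF DF] := FTC1_lebesgue_pt xlt (intf (x - 1) (x + 1)) ax fx.
rewrite derive1E in DF.
have dG : is_derive x 1 (fun y => I (x - 1) y + F (x - 1))%R (f x).
  rewrite -[X in is_derive _ _ _ X]addr0.
  by apply: is_deriveD; apply: DeriveDef.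
apply: near_eq_is_derive dG.
have xab : x \in `]x - 1, x + 1[ by rewrite in_itv/=; lra.
apply: filterS (near_in_itvoo xab) => y; rewrite in_itv/= => /andP[ay yb].
by rewrite -FI ?subrK// !ltW.
Qed.

Lemma continuous_primitive (R : realType) (f : R -> R) : continuous f ->
  exists F : R -> R, forall x : R, is_derive x 1 F (f x).
Proof.
move=> cf; have [|F [_ dF]] := primitive_lebesgue_pt R f.
  move=> x y; apply: continuous_compact_integrable; first exact: segment_compact.
  exact: continuous_subspaceT.
exists F => x; apply: dF; apply: (@continuous_lebesgue_pt _ _ _ setT) => //.
- by split => //; exact: openT.
- exact: continuous_measurable_fun.
- exact: cf.
Qed.

(** Supplies the characteristics: [a] will be the speed [c - pi_i]. Extending it by 0 outside
    [[A, B]] makes the primitive Lipschitz on the whole line, as the sup-convolution assumes. *)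
Lemma bounded_measurable_primitive (R : realType) (a : R -> R) (A B C : R) :
  0 <= C -> measurable_fun [set` `[A, B]] a ->
  (forall s, A <= s <= B -> `|a s| <= C) ->
  exists xi : R -> R, lip C xi /\
    {ae lebesgue_measure, forall s : R, A < s < B -> is_derive s 1 xi (a s)}.
Proof.
move=> C0 ma aC.
pose f := a \_ [set` `[A, B]].
have fC s : `|f s| <= C.
  rewrite /f patchE; case: ifPn => [|_]; last by rewrite normr0.
  by rewrite inE/= in_itv/= => /aC.
have mf (D : set R) : measurable_fun D f.
  by apply: measurable_funTS; apply/(measurable_restrictT _ _).1.
have fini x y : (lebesgue_measure [set` `[x, y]] < +oo)%E.
  by rewrite lebesgue_measure_itv/=; case: ifPn => _; rewrite ?ltry// -EFinB ltry.
have intf x y : lebesgue_measure.-integrable [set` `[x, y]] (EFin \o f).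
  apply: measurable_bounded_integrable => //; [exact: fini|exact: mf|].
  by exists C; split; [exact: num_real|move=> M CM s _ /=; rewrite (le_trans (fC s))// ltW].
have intC x y : lebesgue_measure.-integrable [set` `[x, y]] (EFin \o cst C).
  apply: measurable_bounded_integrable => //; first exact: fini.
  exists C; split; [exact: num_real|move=> M CM s _ /=].
  by rewrite ger0_norm// ltW.
have [F [FI dF]] := primitive_lebesgue_pt R f intf.
have Flip x y : x <= y -> `|F x - F y| <= C * `|x - y|.
  move=> xy; rewrite distrC FI// [`|x - y|]distrC (ger0_norm (_ : 0 <= y - x)) ?subr_ge0//.
  apply: (le_trans (le_normr_Rintegral _ _)) => //.
  apply: (@le_trans _ _ (\int[lebesgue_measure]_(t in `[x, y]) cst C t)).
    apply: le_Rintegral => //.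
    have : lebesgue_measure.-integrable [set` `[x, y]] (abse \o (EFin \o f)).
      exact: integrable_abse.
    by [].
  rewrite Rintegral_cst//= lebesgue_measure_itv/= lte_fin; case: ltP => //= yx.
  by rewrite mulr0 mulr_ge0// subr_ge0.
exists F; split.
  move=> x y; case: (leP x y) => [|/ltW] xy; first exact: Flip.
  by rewrite distrC [`|x - y|]distrC; exact: Flip.
have iA : lebesgue_measure.-integrable [set` `[A, B]] (EFin \o a).
  apply: measurable_bounded_integrable => //; first exact: fini.
  exists C; split; [exact: num_real|move=> M CM s /=].
  by rewrite in_itv/= => /aC /le_trans; apply; exact: ltW.
have := lebesgue_differentiation (integrable_locally (measurable_itv _) iA).
apply: filterS => //; first exact: (ae_filter_ringOfSetsType lebesgue_measure).
move=> s /dF + /andP[As sB]; rewrite /f patchE ifT// inE/= in_itv/=.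
by rewrite !ltW.
Qed.

(** * C^1 majorants of negligible remainders *)

Section modulus.
Context {R : realType} {I : Type} (n e : I -> R) (K : R) (K0 : 0 <= K)
  (eK : forall z, e z <= K * n z)
  (eo : forall eta : R, 0 < eta -> exists2 delta : R, 0 < delta &
    forall z, n z <= delta -> e z <= eta * n z).

(** Here [n z] is the size of an increment and [e z] the remainder there. Increments of size at most
    [|r|] count with their full quotient [e / n]; larger ones are damped by [|r| / n z] instead of
    being cut off. *)
Let val (r : R) z : R := Num.max (e z) 0 / n z * Num.min 1 (`|r| / n z).

Let S (r : R) : set R := [set x | x = 0 \/ exists2 z, 0 < n z & x = val r z].

(* The modulus is nondecreasing in [|r|] while its quotient by [|r|] is
   nonincreasing; this is what makes it continuous. *)
Definition modulus (r : R) : R := sup (S r).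

Let quot_ge0 z : 0 < n z -> 0 <= Num.max (e z) 0 / n z.
Proof. by move=> nz; rewrite divr_ge0// ?(ltW nz)// le_max lexx orbT. Qed.

Let valK r z : 0 < n z -> val r z <= K.
Proof.
move=> nz; apply: (@le_trans _ _ (Num.max (e z) 0 / n z)).
  by rewrite /val ler_piMr ?quot_ge0// ge_min lexx.
by rewrite ler_pdivrMr// ge_max eK/= mulr_ge0// ltW.
Qed.

Let S_ub r x : S r x -> x <= modulus r.
Proof.
move=> Sx; apply: ub_le_sup => //; exists K => _ [->//|[z nz ->]]; exact: valK.
Qed.

Let S_le r M : 0 <= M -> (forall z, 0 < n z -> val r z <= M) -> modulus r <= M.
Proof.
move=> M0 vM; apply: ge_sup; first by exists 0; left.
by move=> _ [->//|[z nz ->]]; exact: vM.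
Qed.

Lemma modulus_ge0 r : 0 <= modulus r.
Proof. by apply: S_ub; left. Qed.

Lemma modulus_le r : modulus r <= K.
Proof. by apply: S_le => // z; exact: valK. Qed.

(** Rests on [min 1 (c a) <= c min 1 a] for [c >= 1]. The case [c = 1] is monotonicity; [c] close to
    1 gives continuity away from 0. *)
Lemma modulus_scale r1 r2 c : 1 <= c -> `|r2| <= c * `|r1| ->
  modulus r2 <= c * modulus r1.
Proof.
move=> c1 r12; have c0 : 0 <= c by exact: le_trans c1.
apply: S_le; first by rewrite mulr_ge0// modulus_ge0.
move=> z nz; apply: (@le_trans _ _ (c * val r1 z)); last first.
  by rewrite ler_wpM2l// S_ub//; right; exists z.
rewrite /val mulrCA ler_wpM2l ?quot_ge0// minr_pMr// mulr1 le_min.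
rewrite !ge_min c1 /=; apply/orP; right.
by rewrite mulrA ler_wpM2r ?invr_ge0 ?(ltW nz).
Qed.

Lemma modulus_homo r1 r2 : `|r1| <= `|r2| -> modulus r1 <= modulus r2.
Proof. by move=> r12; rewrite -[leRHS]mul1r modulus_scale// mul1r. Qed.

Lemma modulus_majorant z r : 0 < n z -> n z <= `|r| -> e z <= modulus r * n z.
Proof.
move=> nz nzr; rewrite -ler_pdivrMr//.
apply: (@le_trans _ _ (val r z)); last by apply: S_ub; right; exists z.
rewrite /val min_l ?mulr1; last by rewrite ler_pdivlMr// mul1r.
by apply: ler_wpM2r; [rewrite invr_ge0 ltW|rewrite le_max lexx].
Qed.

Lemma modulus_small eta : 0 < eta -> exists2 delta : R, 0 < delta &
  forall r, `|r| <= delta -> modulus r <= eta.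
Proof.
move=> eta0; have [d d0 ed] := eo _ eta0.
have c0 : 0 < K + 1 by rewrite ltr_wpDl.
(* Increments larger than [d] contribute at most [K |r| / d], which this radius brings below [eta];
   [K + 1] avoids a division by 0. *)
exists (d * eta / (K + 1)); first by rewrite divr_gt0// mulr_gt0.
move=> r rd; apply: S_le; first exact: ltW.
move=> z nz; case: (leP (n z) d) => [/ed ez|dz].
  apply: (@le_trans _ _ (Num.max (e z) 0 / n z)).
    by rewrite /val ler_piMr ?quot_ge0// ge_min lexx.
  by rewrite ler_pdivrMr// ge_max ez/= mulr_ge0// ltW.
apply: (@le_trans _ _ (K * (`|r| / n z))).
  rewrite /val ler_pM ?quot_ge0//.
  - by rewrite le_min ler01 divr_ge0// ltW.
  - by rewrite ler_pdivrMr// ge_max eK/= mulr_ge0// ltW.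
  - by rewrite ge_min lexx orbT.
rewrite mulrA ler_pdivrMr//.
apply: (@le_trans _ _ ((K + 1) * (d * eta / (K + 1)))).
  by rewrite ler_pM// lerDl.
by rewrite mulrC divfK ?gt_eqF// mulrC ler_wpM2l// ltW.
Qed.

Lemma modulus0 : modulus 0 = 0.
Proof.
apply/eqP; rewrite eq_le modulus_ge0 andbT; apply/ler_addgt0Pr => eta eta0.
by have [d d0 dm] := modulus_small _ eta0; rewrite add0r dm// normr0 ltW.
Qed.

Lemma modulus_continuous : continuous modulus.
Proof.
move=> x; have [->|x0] := eqVneq x 0.
  apply/cvgrPdist_le => /= eta eta0; have [d d0 dm] := modulus_small _ eta0.
  apply: filterS (nbhsx_ballx (0 : R) _ d0) => y; rewrite /ball/= sub0r normrN => yd.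
  by rewrite modulus0 sub0r normrN ger0_norm ?modulus_ge0// dm// ltW.
have x0' : 0 < `|x| by rewrite normr_gt0.
have c0 : 0 < K + 1 by rewrite ltr_wpDl.
apply/cvgrPdist_le => /= eta eta0.
pose t := eta / (K + 1).
have t0 : 0 < t by rewrite divr_gt0.
have tK : t * K <= eta by rewrite /t mulrAC ler_pdivrMr// ler_pM2l// lerDl.
(* The largest radius ensuring [|x| <= (1 + t) |y|]; the reverse comparison then holds too. Both
   moduli differ by at most [t * K <= eta]. *)
pose d := t * `|x| / (1 + t).
have t1 : 0 < 1 + t by rewrite addr_gt0.
have d0 : 0 < d by rewrite divr_gt0// mulr_gt0.
have dE : d * (1 + t) = t * `|x| by rewrite /d divfK ?gt_eqF.
apply: filterS (nbhsx_ballx x _ d0) => y; rewrite /ball/= => yd.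
have m1 : modulus y <= (1 + t) * modulus x.
  apply: modulus_scale; first by rewrite lerDl ltW.
  have := ler_distD x 0 y; rewrite !sub0r !normrN; nra.
have m2 : modulus x <= (1 + t) * modulus y.
  apply: modulus_scale; first by rewrite lerDl ltW.
  have := ler_distD y x 0; rewrite !subr0; nra.
have := modulus_le x; have := modulus_le y; rewrite ler_norml.
move=> yK xK; apply/andP; split; nra.
Qed.
End modulus.

Lemma is_derive_MVT (R : realType) (F f : R -> R) (x y : R) : x <= y ->
  (forall z : R, is_derive z 1 F (f z)) ->
  exists2 z, x <= z <= y & F y - F x = f z * (y - x).
Proof.
move=> xy dF; have [|z] := MVT_segment xy (fun z _ => dF z).
  apply: continuous_subspaceT => z; apply: differentiable_continuous.
  by apply/derivable1_diffP; exact: ex_derive.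
by rewrite in_itv/=; exists z.
Qed.

(** [sigma h] is the integral of the odd function [sg * modulus] from 0 to [2 h]. The stretch
    between [h] and [2 h] alone contributes at least [|h| * modulus h], which dominates every [e z]
    with [n z <= |h|]. The integrand is continuous because the modulus vanishes at 0, and its bound
    [K] gives the linear growth [2 K |h|]. *)
Lemma C1_majorant (R : realType) (I : Type) (n e : I -> R) (K : R) :
  0 <= K -> (forall z, e z <= K * n z) ->
  (forall eta : R, 0 < eta -> exists2 delta : R, 0 < delta &
    forall z, n z <= delta -> e z <= eta * n z) ->
  exists sigma dsigma : R -> R,
   [/\ forall h : R, is_derive h 1 sigma (dsigma h), continuous dsigma,
     sigma 0 = 0 /\ dsigma 0 = 0, forall h, 0 <= sigma h <= 2 * K * `|h| &
     forall z h, 0 <= n z -> n z <= `|h| -> e z <= sigma h].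
Proof.
move=> K0 eK eo.
pose om := modulus n e.
have om0 h : 0 <= om h by exact: modulus_ge0 K0 eK h.
have omK h : om h <= K by exact: modulus_le.
have omM r1 r2 : `|r1| <= `|r2| -> om r1 <= om r2 by exact: modulus_homo K0 eK _ _.
have om00 : om 0 = 0 by exact: modulus0 K0 eK eo.
pose th h := Num.sg h * om h.
have cth : continuous th.
  move=> x; have [->|x0] := eqVneq x 0; apply/cvgrPdist_le => /= eta eta0.
    have [d d0 dm] := modulus_small n e K K0 eK eo _ eta0.
    apply: filterS (nbhsx_ballx (0 : R) _ d0) => y; rewrite /ball/= sub0r normrN => yd.
    rewrite {1}/th om00 mulr0 sub0r normrN normrM (ger0_norm (om0 y)).
    rewrite -[leRHS]mul1r ler_pM//; last by apply: dm; exact: ltW.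
    by rewrite normr_sg lern1 leq_b1.
  have x0' : 0 < `|x| by rewrite normr_gt0.
  have /cvgrPdist_le/(_ _ eta0) := modulus_continuous n e K K0 eK eo x.
  apply: filterS2 (nbhsx_ballx x _ x0') => y; rewrite /ball/= => yx omy.
  have -> : th y = Num.sg x * om y.
    congr (_ * _); move: x0 yx; rewrite neq_lt => /orP[x0|x0].
      by rewrite (ltr0_norm x0) ltr_norml => ?; rewrite !ltr0_sg//; lra.
    by rewrite (gtr0_norm x0) ltr_norml => ?; rewrite !gtr0_sg//; lra.
  by rewrite -mulrBr normrM normr_sg x0 mul1r.
have [G dG] := continuous_primitive _ _ cth.
pose F x := G x - G 0.
have dF (x : R) : is_derive x 1 F (th x).
  rewrite -[th x]subr0; apply: is_deriveB.
have F0 : F 0 = 0 by rewrite /F subrr.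
have F2_ge h : `|h| * om h <= F (2 * h).
  case: (leP 0 h) => h0.
    have [|z /andP[hz _] E] := @is_derive_MVT _ F th h (2 * h) _ dF; first lra.
    have [|z' /andP[hz' _] E'] := @is_derive_MVT _ F th 0 h _ dF; first by [].
    rewrite F0 !subr0 in E'.
    have : om h <= th z.
      have [h00|hp] := eqVneq h 0; first by rewrite h00 om00 /th mulr_ge0// sgr_ge0 -h00.
      rewrite /th gtr0_sg ?mul1r ?omM//; last first.
        by apply: lt_le_trans hz; rewrite lt_neqAle eq_sym hp.
      by rewrite !ger0_norm// (le_trans h0).
    have : 0 <= th z' by rewrite /th mulr_ge0// sgr_ge0.
    rewrite ger0_norm//; nra.
  have [|z /andP[_ hz] E] := @is_derive_MVT _ F th (2 * h) h _ dF; first lra.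
  have [|z' /andP[_ hz'] E'] := @is_derive_MVT _ F th h 0 _ dF; first exact: ltW.
  have zh : th z <= - om h.
    have z0 : z < 0 by exact: le_lt_trans h0.
    by rewrite /th ltr0_sg// mulN1r lerN2 omM// !ltr0_norm// lerN2.
  have z'h : th z' <= 0 by rewrite /th mulr_le0_ge0 ?sgr_le0.
  by rewrite ltr0_norm//; nra.
have F2_le h : F (2 * h) <= 2 * K * `|h|.
  have thK z : `|th z| <= K.
    rewrite normrM (ger0_norm (om0 z)) -[leRHS]mul1r ler_pM//.
    by rewrite normr_sg lern1 leq_b1.
  case: (leP 0 h) => h0.
    have [|z _] := @is_derive_MVT _ F th 0 (2 * h) _ dF; first by rewrite mulr_ge0.
    rewrite F0 !subr0 => ->; rewrite ger0_norm//.
    by have := thK z; rewrite ler_norml => /andP[_ ?]; nra.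
  have [|z _] := @is_derive_MVT _ F th (2 * h) 0 _ dF; first by lra.
  rewrite F0 !sub0r ltr0_norm// => E.
  have := thK z; rewrite ler_norml => /andP[thz _].
  have : 0 <= - h * (th z + K) by rewrite mulr_ge0//; lra.
  by nra.
exists (fun h => F (2 * h)), (fun h => 2 * th (2 * h)); split.
- move=> h; have -> : (fun h => F (2 * h)) = F \o ( *%R 2) by [].
  apply: is_derive_eq; last first.
  by rewrite /GRing.scale/=; ring.
- move=> h; apply: cvgM; first exact: cvg_cst.
  apply: (@cvg_comp _ _ _ ( *%R 2) th); last exact: cth.
  exact: mulrl_continuous.
- by rewrite mulr0 F0 /th om00 !mulr0.
- move=> h; rewrite F2_le andbT; apply: le_trans (F2_ge h).
  by rewrite mulr_ge0.
- move=> z h; rewrite le_eqVlt => /predU1P[nz _|nz nzh].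
    apply: (le_trans (eK z)); rewrite -nz mulr0.
    by apply: le_trans (F2_ge h); rewrite mulr_ge0.
  apply: le_trans (F2_ge h).
  apply: (le_trans (modulus_majorant n e K K0 eK z h nz nzh)).
  by rewrite mulrC ler_wpM2r.
Qed.

(** * Construction of test functions *)

Lemma is_derive_dir (R : realType) (f : R -> R) (a df v : R) :
  is_derive a 1 f df -> is_derive a v f (v * df).
Proof.
move=> dfa; have fdiff : differentiable f a by apply/derivable1_diffP; exact: ex_derive.
apply: DeriveDef; first exact: diff_derivable.
rewrite deriveE// -[v in LHS]mulr1 -[v * 1]/(v *: 1 : R) linearZ/= -deriveE// derive_val.
by [].
Qed.

Definition C1_on {R : realType} (f df : R -> R) :=
  (forall h : R, is_derive h 1 f (df h)) /\ continuous df.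

(** The partial derivatives are carried as explicit functions, so that the gradient of a sum or
    product at the touching point is found by substitution. *)
Definition C1_grad {R : realType} (f ft fs fx : point3 R -> R) :=
  [/\ continuous f, [/\ continuous ft, continuous fs & continuous fx] &
    forall z, [/\ is_derive z e_t f (ft z), is_derive z e_s f (fs z) &
                  is_derive z e_x f (fx z)]].

Section C1_grad.
Context {R : realType}.
Implicit Types (f g : point3 R -> R) (s ds : R -> R).

Lemma C1_grad_C1 f ft fs fx : C1_grad f ft fs fx -> C1 f.
Proof.
move=> [_ [ct cs cx] df] e; case=> ->; split=> [z|].
- by have [? _ _] := df z; exact: ex_derive.
- by rewrite (_ : (fun _ => _) = ft)//; apply/funext => z; have [? _ _] := df z; exact: derive_val.
- by have [_ ? _] := df z; exact: ex_derive.
- by rewrite (_ : (fun _ => _) = fs)//; apply/funext => z; have [_ ? _] := df z; exact: derive_val.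
- by have [_ _ ?] := df z; exact: ex_derive.
- by rewrite (_ : (fun _ => _) = fx)//; apply/funext => z; have [_ _ ?] := df z; exact: derive_val.
Qed.

Lemma C1_on_continuous s ds : C1_on s ds -> continuous s.
Proof.
move=> [ds' _] z; apply: differentiable_continuous.
by apply/derivable1_diffP; exact: ex_derive.
Qed.

Lemma cst0_continuous : continuous (fun _ : point3 R => 0 : R).
Proof. by move=> z; exact: cvg_cst. Qed.

Lemma C1_grad_t s ds : C1_on s ds ->
  C1_grad (fun z => s z.1.1) (fun z => ds z.1.1) (fun=> 0) (fun=> 0).
Proof.
move=> C; have [D c] := C.
have p : continuous (fun z : point3 R => z.1.1).
  by move=> z; apply: cvg_comp; [exact: cvg_fst|exact: cvg_fst].
have cs := C1_on_continuous _ _ C.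
split; first by move=> z; apply: continuous_comp; [exact: p|exact: cs].
  split; [|exact: cst0_continuous..].
  by move=> z; apply: continuous_comp; [exact: p|exact: c].
move=> z; split.
- have := is_derive_dir R s z.1.1 _ 1 (D _); rewrite mul1r => -[d v].
  by apply: DeriveDef; [exact: d|exact: v].
- have := is_derive_dir R s z.1.1 _ 0 (D _); rewrite mul0r => -[d v].
  by apply: DeriveDef; [exact: d|exact: v].
- have := is_derive_dir R s z.1.1 _ 0 (D _); rewrite mul0r => -[d v].
  by apply: DeriveDef; [exact: d|exact: v].
Qed.
Lemma C1_grad_s s ds : C1_on s ds ->
  C1_grad (fun z => s z.1.2) (fun=> 0) (fun z => ds z.1.2) (fun=> 0).
Proof.
move=> C; have [D c] := C.
have p : continuous (fun z : point3 R => z.1.2).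
  by move=> z; apply: cvg_comp; [exact: cvg_fst|exact: cvg_snd].
have cs := C1_on_continuous _ _ C.
split; first by move=> z; apply: continuous_comp; [exact: p|exact: cs].
  split; [exact: cst0_continuous| |exact: cst0_continuous].
  by move=> z; apply: continuous_comp; [exact: p|exact: c].
move=> z; split.
- have := is_derive_dir R s z.1.2 _ 0 (D _); rewrite mul0r => -[d v].
  by apply: DeriveDef; [exact: d|exact: v].
- have := is_derive_dir R s z.1.2 _ 1 (D _); rewrite mul1r => -[d v].
  by apply: DeriveDef; [exact: d|exact: v].
- have := is_derive_dir R s z.1.2 _ 0 (D _); rewrite mul0r => -[d v].
  by apply: DeriveDef; [exact: d|exact: v].
Qed.
Lemma C1_grad_x s ds : C1_on s ds ->
  C1_grad (fun z => s z.2) (fun=> 0) (fun=> 0) (fun z => ds z.2).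
Proof.
move=> C; have [D c] := C.
have p : continuous (fun z : point3 R => z.2).
  by move=> z; exact: cvg_snd.
have cs := C1_on_continuous _ _ C.
split; first by move=> z; apply: continuous_comp; [exact: p|exact: cs].
  split; [exact: cst0_continuous..|].
  by move=> z; apply: continuous_comp; [exact: p|exact: c].
move=> z; split.
- have := is_derive_dir R s z.2 _ 0 (D _); rewrite mul0r => -[d v].
  by apply: DeriveDef; [exact: d|exact: v].
- have := is_derive_dir R s z.2 _ 0 (D _); rewrite mul0r => -[d v].
  by apply: DeriveDef; [exact: d|exact: v].
- have := is_derive_dir R s z.2 _ 1 (D _); rewrite mul1r => -[d v].
  by apply: DeriveDef; [exact: d|exact: v].
Qed.

Lemma C1_grad_add f ft fs fx g gt gs gx :
  C1_grad f ft fs fx -> C1_grad g gt gs gx ->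
  C1_grad (fun z => f z + g z) (fun z => ft z + gt z) (fun z => fs z + gs z)
    (fun z => fx z + gx z).
Proof.
move=> [cf [cft cfs cfx] df] [cg [cgt cgs cgx] dg]; split.
- by move=> z; apply: cvgD; [exact: cf|exact: cg].
- split=> z; apply: cvgD; by [exact: cft|exact: cfs|exact: cfx|exact: cgt|exact: cgs|exact: cgx].
- by move=> z; have [? ? ?] := df z; have [? ? ?] := dg z; split; exact: is_deriveD.
Qed.

Lemma C1_grad_mul f ft fs fx g gt gs gx :
  C1_grad f ft fs fx -> C1_grad g gt gs gx ->
  C1_grad (fun z => f z * g z) (fun z => f z * gt z + g z * ft z)
    (fun z => f z * gs z + g z * fs z) (fun z => f z * gx z + g z * fx z).
Proof.
move=> [cf [cft cfs cfx] df] [cg [cgt cgs cgx] dg]; split.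
- by move=> z; apply: cvgM; [exact: cf|exact: cg].
- split=> z; (apply: cvgD; apply: cvgM);
  by [exact: cf|exact: cg|exact: cft|exact: cfs|exact: cfx|exact: cgt|exact: cgs|exact: cgx].
- by move=> z; have [? ? ?] := df z; have [? ? ?] := dg z; split; exact: is_deriveM.
Qed.

Lemma C1_grad_opp f ft fs fx : C1_grad f ft fs fx ->
  C1_grad (fun z => - f z) (fun z => - ft z) (fun z => - fs z) (fun z => - fx z).
Proof.
move=> [cf [cft cfs cfx] df]; split.
- by move=> z; apply: cvgN; exact: cf.
- split=> z; apply: cvgN; by [exact: cft|exact: cfs|exact: cfx].
- by move=> z; have [? ? ?] := df z; split; exact: is_deriveN.
Qed.

End C1_grad.

Lemma C1_on_quad (R : realType) (A B C a : R) :
  C1_on (fun x => A + B * (x - a) + C * (x - a) ^+ 2) (fun x => B + 2 * C * (x - a)).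
Proof.
split=> h.
  apply: is_derive_eq.
  by rewrite /GRing.scale/=; ring.
apply: cvgD; first exact: cvg_cst.
apply: cvgM; first exact: cvg_cst.
by apply: cvgB; [exact: cvg_id|exact: cvg_cst].
Qed.

Lemma C1_on_mul (R : realType) (f df g dg : R -> R) : C1_on f df -> C1_on g dg ->
  C1_on (fun x => f x * g x) (fun x => f x * dg x + g x * df x).
Proof.
move=> Cf Cg; have cf := C1_on_continuous _ _ Cf; have cg := C1_on_continuous _ _ Cg.
have [Df cdf] := Cf; have [Dg cdg] := Cg; split=> h.
  exact: is_deriveM.
by apply: cvgD; apply: cvgM; [exact: cf|exact: cdg|exact: cg|exact: cdf].
Qed.

Lemma C1_on_inv (R : realType) (f df : R -> R) : (forall x, 0 < f x) -> C1_on f df ->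
  C1_on (fun x => (f x)^-1) (fun x => - df x / f x ^+ 2).
Proof.
move=> f0 Cf; have cf := C1_on_continuous _ _ Cf; have [Df cdf] := Cf; split=> h.
  have fn0 : f h != 0 by rewrite gt_eqF.
  apply: is_derive_eq.
  by rewrite /GRing.scale/= !mulNr mulrC.
apply: cvgM; first by apply: cvgN; exact: cdf.
apply: cvgV; first by rewrite expf_neq0// gt_eqF.
by rewrite !expr2; apply: cvgM; exact: cf.
Qed.

Lemma C1_on_shift (R : realType) (f df : R -> R) (a : R) : C1_on f df ->
  C1_on (fun x => f (x - a)) (fun x => df (x - a)).
Proof.
move=> [Df cdf]; split=> h.
  have D1 : is_derive h 1 (fun x : R => x - a) (1 : R).
    by apply: is_derive_eq; rewrite subr0.
  by have := @is_derive1_comp _ f (fun x => x - a) h _ _ (Df _) D1; rewrite mulr1.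
apply: continuous_comp; last exact: cdf.
by apply: cvgB; [exact: cvg_id|exact: cvg_cst].
Qed.

(** * Global C^1 majorants of Lipschitz functions *)

Definition lip3 {R : realType} (L : R) (u : point3 R -> R) := forall t s x t' s' x',
  `|u (t, s, x) - u (t', s', x')| <= L * (`|t - t'| + `|s - s'| + `|x - x'|).

Definition growth2 {R : realType} (f : point3 R -> R) := forall B : R, exists2 K : R,
  0 <= K & forall t s x, `|t| <= B -> `|s| <= B -> `|f (t, s, x)| <= K * (1 + x ^+ 2).

Section majorant.
Context {R : realType}.
Implicit Types (f g k u : point3 R -> R).

Lemma lip3_ge0 L u : lip3 L u -> 0 <= L.
Proof.
move=> /(_ 1 0 0 0 0 0); rewrite !subrr normr0 !addr0 subr0 normr1 mulr1.
exact: le_trans.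
Qed.

Lemma growth2_add f g : growth2 f -> growth2 g -> growth2 (fun z => f z + g z).
Proof.
move=> gf gg B; have [K K0 fK] := gf B; have [K' K'0 gK] := gg B.
exists (K + K'); first exact: addr_ge0.
move=> t s x tB sB; rewrite (le_trans (ler_normD _ _))// mulrDl.
by apply: lerD; [exact: fK|exact: gK].
Qed.

Lemma growth2_mul k f : (forall z, 0 <= k z <= 1) -> growth2 f ->
  growth2 (fun z => k z * f z).
Proof.
move=> k01 gf B; have [K K0 fK] := gf B; exists K => // t s x tB sB.
have /andP[k0 k1] := k01 (t, s, x).
rewrite normrM (ger0_norm k0) (le_trans _ (fK _ _ _ tB sB))//.
by rewrite ler_piMl.
Qed.

Lemma lip3_growth2 L u : lip3 L u -> growth2 u.
Proof.
move=> uL B; have L0 := lip3_ge0 _ _ uL.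
pose A := `|B|.
exists (`|u (0, 0, 0)| + L * (2 * A + 1)).
  by rewrite addr_ge0// mulr_ge0// addr_ge0// mulr_ge0// /A.
move=> t s x tB sB.
have {}tB : `|t| <= A by rewrite (le_trans tB)// ler_norm.
have {}sB : `|s| <= A by rewrite (le_trans sB)// ler_norm.
have := uL t s x 0 0 0; rewrite !subr0 => uz.
have x2 : `|x| <= 1 + x ^+ 2 by rewrite -(real_normK (num_real _)); nra.
have : `|u (t, s, x)| <= `|u (0, 0, 0)| + L * (`|t| + `|s| + `|x|).
  by rewrite -lerBlDl (le_trans _ uz)// lerB_dist.
move/le_trans; apply.
have xx : 0 <= x ^+ 2 by exact: sqr_ge0.
rewrite mulrDl lerD//; first by rewrite ler_peMr// lerDl.
rewrite -mulrA ler_wpM2l//.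
have A0 : 0 <= A by rewrite /A.
nra.
Qed.

Lemma convex_growth2 k f g : (forall z, 0 <= k z <= 1) -> growth2 f -> growth2 g ->
  growth2 (fun z => k z * f z + (1 - k z) * g z).
Proof.
move=> k01 gf gg; apply: growth2_add; first exact: growth2_mul.
by apply: growth2_mul => // z; have := k01 z; lra.
Qed.

Lemma continuous_bounded_itv (phi : R -> R) (B : R) : continuous phi ->
  exists2 K, 0 <= K & forall t, `|t| <= B -> `|phi t| <= K.
Proof.
move=> cphi; have [B0|B0] := ltP B 0.
  by exists 0 => // t /(le_trans (normr_ge0 _)); rewrite leNgt B0.
have BB : - B <= B by lra.
have cn : continuous (fun t => `|phi t|).
  by move=> t; apply: cvg_norm; exact: cphi.
have [c _ cmax] := EVT_max BB (continuous_subspaceT cn).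
exists `|phi c| => // t; rewrite ler_norml => tB.
by apply: cmax; rewrite in_itv.
Qed.

Lemma growth2_t (phi : R -> R) : continuous phi -> growth2 (fun z => phi z.1.1).
Proof.
move=> cphi B; have [K K0 pK] := continuous_bounded_itv phi B cphi.
exists K => // t s x tB _ /=; rewrite (le_trans (pK _ tB))// ler_peMr//.
by rewrite lerDl sqr_ge0.
Qed.

Lemma growth2_s (phi : R -> R) : continuous phi -> growth2 (fun z => phi z.1.2).
Proof.
move=> cphi B; have [K K0 pK] := continuous_bounded_itv phi B cphi.
exists K => // t s x _ sB /=; rewrite (le_trans (pK _ sB))// ler_peMr//.
by rewrite lerDl sqr_ge0.
Qed.

(** Along the line [(t1, s1, .)] the function is averaged over [[x, x + d]], which makes it C^1, and
    raised by [L d] to lie above [u]. Off the line, the variation [L |h|] in [t] and in [s] is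
    absorbed by [L d + (L / d) h^2]. *)
Lemma smooth_majorant L u (t1 s1 eta : R) : lip3 L u -> 0 < eta ->
  exists b bt bs bx, [/\ C1_grad b bt bs bx, growth2 b, forall z, u z <= b z &
    forall x, b (t1, s1, x) <= u (t1, s1, x) + eta].
Proof.
move=> uL eta0; have L0 := lip3_ge0 _ _ uL.
(* The error on the line is at most [4 L d]: [2 L d] from the raised average and [L d] from each of
   the two quadratics. *)
pose d := eta / (4 * L + 1).
have L1 : 0 < 4 * L + 1 by lra.
have d0 : 0 < d by rewrite divr_gt0.
have Ld : 0 <= 2 * L * d by rewrite mulr_ge0 ?(ltW d0)// mulr_ge0.
have dL : 4 * L * d <= eta.
  by rewrite /d mulrCA ler_piMr ?(ltW eta0)// ler_pdivrMr// mul1r lerDl.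
have cu : continuous (fun x => u (t1, s1, x)).
  apply: (lip_continuous _ L) => x y.
  by have := uL t1 s1 x t1 s1 y; rewrite !subrr normr0 !add0r.
have [F dF] := continuous_primitive _ _ cu.
have CF : C1_on F (fun x => u (t1, s1, x)) by split.
pose m x := (F (x - - d) - F x) / d + L * d.
have m_close x : u (t1, s1, x) <= m x <= u (t1, s1, x) + 2 * L * d.
  have [|y /andP[xy yx] E] := @is_derive_MVT _ F _ x (x - - d) _ dF; first by lra.
  have -> : m x = u (t1, s1, y) + L * d.
    by rewrite /m E opprK addrAC subrr add0r mulfK// gt_eqF.
  have := uL t1 s1 x t1 s1 y; rewrite !subrr normr0 !add0r ler_norml => /andP[].
  have xy0 : x - y <= 0 by lra.
  rewrite (ler0_norm xy0) => u1 u2; rewrite opprK in yx.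
  have : L * (y - x) <= L * d by rewrite ler_wpM2l//; lra.
  by move=> ?; apply/andP; split; lra.
pose dm x := (u (t1, s1, x - - d) - u (t1, s1, x)) / d.
have Cm : C1_on m dm.
  have [D c] := C1_on_shift _ _ _ (- d) CF.
  split=> h.
    rewrite /m; apply: is_derive_eq.
    by rewrite /GRing.scale/= /dm; ring.
  apply: cvgM; last exact: cvg_cst.
  by apply: cvgB; [exact: c|exact: cu].
have Ct := C1_grad_t _ _ (C1_on_quad R (L * d) 0 (L / d) t1).
have Cs := C1_grad_s _ _ (C1_on_quad R (L * d) 0 (L / d) s1).
have Cx := C1_grad_x _ _ Cm.
have quad h : L * `|h| <= L * d + L / d * h ^+ 2.
  rewrite -mulrA -mulrDr ler_wpM2l// -(real_normK (num_real _)).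
  have [hd|dh] := leP `|h| d; first by rewrite (le_trans hd)// lerDl mulr_ge0// invr_ge0 ltW.
  rewrite (@le_trans _ _ (d^-1 * `|h| ^+ 2))//; last by rewrite lerDr ltW.
  by rewrite mulrC ler_pdivlMr// expr2 ler_wpM2l// ltW.
do 4 eexists; split.
- exact: C1_grad_add Cx (C1_grad_add _ _ _ _ _ _ _ _ Ct Cs).
- apply: growth2_add.
    move=> B; have [K K0 uK] := lip3_growth2 _ _ uL (`|t1| + `|s1|).
    exists (K + 2 * L * d); first by rewrite addr_ge0.
    move=> t s x _ _ /=; have /andP[m1 m2] := m_close x.
    have := uK t1 s1 x; rewrite lerDl lerDr !normr_ge0 => /(_ isT isT).
    have xx : 0 <= x ^+ 2 by exact: sqr_ge0.
    rewrite !ler_norml => /andP[? ?]; apply/andP; split; nra.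
  apply: growth2_add.
    exact: (growth2_t _ (C1_on_continuous _ _ (C1_on_quad R (L * d) 0 (L / d) t1))).
  exact: (growth2_s _ (C1_on_continuous _ _ (C1_on_quad R (L * d) 0 (L / d) s1))).
- move=> [[t s] x] /=; have /andP[m1 _] := m_close x.
  have := uL t s x t1 s1 x; rewrite subrr normr0 addr0 ler_norml => /andP[_].
  by have := quad (t - t1); have := quad (s - s1); rewrite !mul0r !addr0; lra.
- move=> x /=; have /andP[_ m2] := m_close x.
  by rewrite !subrr expr0n/= !mulr0 !addr0; lra.
Qed.
End majorant.

(* [r] stands for any bound on the max norm of the increment. *)
Definition superjet {R : realType} (u : point3 R -> R) (t0 s0 x0 pt ps px : R) :=
  forall eta : R, 0 < eta -> exists2 delta : R, 0 < delta &
    forall t s x r, `|t - t0| <= r -> `|s - s0| <= r -> `|x - x0| <= r -> r <= delta ->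
      u (t, s, x) <= u (t0, s0, x0) + pt * (t - t0) + ps * (s - s0) + px * (x - x0) + eta * r.

Section touching.
Context {R : realType}.
Implicit Types (f g k u : point3 R -> R).

Lemma C1_on_add (f df g dg : R -> R) : C1_on f df -> C1_on g dg ->
  C1_on (fun x => f x + g x) (fun x => df x + dg x).
Proof.
move=> [Df cdf] [Dg cdg]; split=> h; first exact: is_deriveD.
by apply: cvgD; [exact: cdf|exact: cdg].
Qed.

Lemma C1_grad_ext f ft fs fx g gt gs gx : C1_grad f ft fs fx ->
  f =1 g -> ft =1 gt -> fs =1 gs -> fx =1 gx -> C1_grad g gt gs gx.
Proof. by move=> C /funext <- /funext <- /funext <- /funext <-. Qed.

Lemma C1_grad_interp k kt ks kx f ft fs fx g gt gs gx :
  C1_grad k kt ks kx -> C1_grad f ft fs fx -> C1_grad g gt gs gx ->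
  C1_grad (fun z => k z * f z + (1 - k z) * g z)
    (fun z => k z * ft z + (f z - g z) * kt z + (1 - k z) * gt z)
    (fun z => k z * fs z + (f z - g z) * ks z + (1 - k z) * gs z)
    (fun z => k z * fx z + (f z - g z) * kx z + (1 - k z) * gx z).
Proof.
move=> Ck Cf Cg.
have C := C1_grad_add _ _ _ _ _ _ _ _ (C1_grad_mul _ _ _ _ _ _ _ _ Ck Cf)
  (C1_grad_add _ _ _ _ _ _ _ _ Cg (C1_grad_opp _ _ _ _ (C1_grad_mul _ _ _ _ _ _ _ _ Ck Cg))).
by apply: C1_grad_ext C _ _ _ _ => z /=; ring.
Qed.

Lemma growth2_x (phi : R -> R) (K : R) : 0 <= K ->
  (forall x, `|phi x| <= K * (1 + x ^+ 2)) -> growth2 (fun z => phi z.2).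
Proof. by move=> K0 pK B; exists K. Qed.

Lemma lorentz_cutoff (x0 r : R) : 0 < r -> exists k dk : R -> R,
  [/\ C1_on k dk, forall x, 0 <= k x <= 1, k x0 = 1, dk x0 = 0 &
    forall x, k x * `|x - x0| <= r].
Proof.
move=> r0; have r20 : 0 < (r ^+ 2)^-1 by rewrite invr_gt0 exprn_gt0.
pose q x := 1 + 0 * (x - x0) + (r ^+ 2)^-1 * (x - x0) ^+ 2.
have q1 x : 1 <= q x.
  by rewrite /q mul0r addr0 lerDl mulr_ge0// ?sqr_ge0// ltW.
have q0 x : 0 < q x by exact: lt_le_trans (q1 x).
have C := C1_on_inv _ _ _ q0 (C1_on_quad R 1 0 (r ^+ 2)^-1 x0).
do 2 eexists; split; first exact: C.
- by move=> x; rewrite invr_ge0 ltW//= invf_le1.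
- by rewrite /q subrr expr0n/= !mulr0 !addr0 invr1.
- by rewrite /= subrr mulr0 addr0 oppr0 mul0r.
- move=> x /=; rewrite mulrC ler_pdivrMr// /q mul0r addr0.
  have -> : (x - x0) ^+ 2 = `|x - x0| ^+ 2 by rewrite real_normK// num_real.
  move: (`|x - x0|) (normr_ge0 (x - x0)) => h h0.
  have -> : r * (1 + (r ^+ 2)^-1 * h ^+ 2) = r + h ^+ 2 / r by field; rewrite gt_eqF.
  have [hr|rh] := leP h r; first by rewrite (le_trans hr)// lerDl divr_ge0 ?sqr_ge0// ltW.
  rewrite (@le_trans _ _ (h ^+ 2 / r))//; last by rewrite lerDr ltW.
  by rewrite ler_pdivlMr// expr2 ler_wpM2l// ltW.
Qed.

(** The function [s^2 / (s^2 + (s - s0)^2)]. Positivity of [s0] enters because the lines [s = s0]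
    and [s = 0] must be told apart. *)
Lemma separating_cutoff (s0 : R) : 0 < s0 -> exists k dk : R -> R,
  [/\ C1_on k dk, forall s, 0 <= k s <= 1, k s0 = 1, dk s0 = 0 & k 0 = 0].
Proof.
move=> s00.
(* The denominator [s^2 + (s - s0)^2] with its square completed at [s0 / 2], to match
   [C1_on_quad]. *)
pose q s := s0 ^+ 2 / 2 + 0 * (s - s0 / 2) + 2 * (s - s0 / 2) ^+ 2.
have qE s : q s = s ^+ 2 + (s - s0) ^+ 2 by rewrite /q; field.
have q0 x : 0 < q x.
  by rewrite /q mul0r addr0 ltr_wpDr// ?divr_gt0 ?exprn_gt0// mulr_ge0 ?sqr_ge0.
have C := C1_on_mul _ _ _ _ _ (C1_on_quad R 0 0 1 0)
  (C1_on_inv _ _ _ q0 (C1_on_quad R (s0 ^+ 2 / 2) 0 2 (s0 / 2))).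
do 2 eexists; split; first exact: C.
- move=> s /=; rewrite !subr0 !mul0r !add0r mul1r divr_ge0 ?sqr_ge0 ?(ltW (q0 _))//=.
  by rewrite ler_pdivrMr// mul1r qE lerDl sqr_ge0.
- rewrite /= qE subrr expr0n/= !subr0 !mul0r !add0r !addr0 mul1r divff//.
  by rewrite expf_neq0// gt_eqF.
- rewrite /= qE subrr expr0n/=; field; by rewrite gt_eqF.
- by rewrite /= !subr0 expr0n/= !mulr0 !addr0 mul0r.
Qed.

Lemma le_convex (a f g k : R) : 0 <= k <= 1 -> a <= f -> a <= g ->
  a <= k * f + (1 - k) * g.
Proof. by move=> /andP[k0 k1] af ag; nra. Qed.

(* The first-order expansion [Phi] of [u], corrected by a C^1 majorant of the
   remainder, lies above [u] but far from it away from the touching point.  It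
   is therefore interpolated with majorants close to [u] on the two lines seen
   by the generator; the cutoffs have a maximum at the touching point, so that
   the gradient there is that of [Phi]. *)
Lemma touching_function L u (t0 s0 x0 pt ps px eta : R) :
  lip3 L u -> 0 < s0 -> superjet u t0 s0 x0 pt ps px -> 0 < eta ->
  exists b bt bs bx, [/\ C1_grad b bt bs bx /\ growth2 b, forall z, u z <= b z,
    [/\ b (t0, s0, x0) = u (t0, s0, x0), bt (t0, s0, x0) = pt,
        bs (t0, s0, x0) = ps & bx (t0, s0, x0) = px],
    forall x, b (t0, s0, x) <= u (t0, s0, x) + eta &
    forall x, b (t0, 0, x) <= u (t0, 0, x) + eta].
Proof.
move=> uL s00 ju eta0; have L0 := lip3_ge0 _ _ uL.
pose n (z : R * R * R) := Num.max (Num.max `|z.1.1 - t0| `|z.1.2 - s0|) `|z.2 - x0|.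
pose e (z : R * R * R) := u z - u (t0, s0, x0)
  - (pt * (z.1.1 - t0) + ps * (z.1.2 - s0) + px * (z.2 - x0)).
pose K := 3 * L + `|pt| + `|ps| + `|px|.
have K0 : 0 <= K by rewrite /K !addr_ge0// mulr_ge0.
have nE z : [/\ `|z.1.1 - t0| <= n z, `|z.1.2 - s0| <= n z & `|z.2 - x0| <= n z].
  by rewrite /n !le_max !lexx !orbT.
have eK z : e z <= K * n z.
  case: z => [[t s] x]; have /= [nt ns nx] := nE (t, s, x); rewrite /e/=.
  have := uL t s x t0 s0 x0; rewrite ler_norml => /andP[_ uu].
  have pE p h : `|h| <= n (t, s, x) -> - (p * h) <= `|p| * n (t, s, x).
    move=> hn; rewrite (@le_trans _ _ `|p * h|)//; first by rewrite -normrN ler_norm.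
    by rewrite normrM ler_wpM2l.
  have := pE pt _ nt; have := pE ps _ ns; have := pE px _ nx.
  have : L * (`|t - t0| + `|s - s0| + `|x - x0|) <= L * (3 * n (t, s, x)).
    by rewrite ler_wpM2l//; lra.
  by rewrite /K; lra.
have eo (ep : R) : 0 < ep -> exists2 delta : R, 0 < delta &
    forall z, n z <= delta -> e z <= ep * n z.
  move=> /ju[d d0 ud]; exists d => // -[[t s] x] nd; have /= [nt ns nx] := nE (t, s, x).
  by have := ud _ _ _ _ nt ns nx nd; rewrite /e/=; lra.
have [sg [dsg [dS cS [S0 dS0] SK Se]]] := C1_majorant R _ n e K K0 eK eo.
have CS a : C1_on (fun h => sg (h - a)) (fun h => dsg (h - a)) by apply: C1_on_shift; split.
have CA p a := C1_on_add _ _ _ _ (C1_on_quad R 0 p 0 a) (CS a).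
have Phi := C1_grad_add _ _ _ _ _ _ _ _
  (C1_grad_add _ _ _ _ _ _ _ _ (C1_grad_t _ _ (C1_on_quad R (u (t0, s0, x0)) 0 0 0))
     (C1_grad_t _ _ (CA pt t0)))
  (C1_grad_add _ _ _ _ _ _ _ _ (C1_grad_s _ _ (CA ps s0)) (C1_grad_x _ _ (CA px x0))).
have [b1 [b1t [b1s [b1x [C1b g1b ub1 b1u]]]]] :=
  smooth_majorant L u t0 s0 (eta / 2) uL (divr_gt0 eta0 (ltr0n _ 2)).
have [b0 [b0t [b0s [b0x [C0b g0b ub0 b0u]]]]] := smooth_majorant L u t0 0 eta uL eta0.
(* On the line [(t0, s0, .)] the corrected expansion exceeds [u] by at most [C |x - x0|]. The cutoff
   width below reduces this to [eta / 2], and [b1] spends the other half of [eta]. *)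
pose C := `|px| + 2 * K + L.
have C0 : 0 <= C by rewrite /C !addr_ge0// mulr_ge0.
have r0 : 0 < eta / 2 / (C + 1) by rewrite !divr_gt0// ltr_wpDl.
have [k [dk [Ck k01 kx0 dkx0 kr]]] := lorentz_cutoff x0 _ r0.
have [ka [dka [Cka ka01 kas0 dkas0 ka0]]] := separating_cutoff s0 s00.
have B1 := C1_grad_interp _ _ _ _ _ _ _ _ _ _ _ _ (C1_grad_x _ _ Ck) Phi C1b.
(* [B1] takes care of the line [s = s0]; at [s = 0] only [b0] is left, since [ka] vanishes there. *)
have B := C1_grad_interp _ _ _ _ _ _ _ _ _ _ _ _ (C1_grad_s _ _ Cka) B1 C0b.
(* The max norm [n z] is attained by one coordinate, whose [sg] alone dominates the remainder; the
   other two are nonnegative. *)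
have uPhi z : u z <= u (t0, s0, x0) + 0 * (z.1.1 - 0) + 0 * (z.1.1 - 0) ^+ 2 +
    (0 + pt * (z.1.1 - t0) + 0 * (z.1.1 - t0) ^+ 2 + sg (z.1.1 - t0)) +
    (0 + ps * (z.1.2 - s0) + 0 * (z.1.2 - s0) ^+ 2 + sg (z.1.2 - s0) +
     (0 + px * (z.2 - x0) + 0 * (z.2 - x0) ^+ 2 + sg (z.2 - x0))).
  have n0 : 0 <= n z by rewrite le_max normr_ge0 orbT.
  have /andP[St _] := SK (z.1.1 - t0); have /andP[Ss _] := SK (z.1.2 - s0).
  have /andP[Sx _] := SK (z.2 - x0).
  suff : e z <= sg (z.1.1 - t0) + sg (z.1.2 - s0) + sg (z.2 - x0) by rewrite /e; lra.
  have : [|| n z <= `|z.1.1 - t0|, n z <= `|z.1.2 - s0| | n z <= `|z.2 - x0|].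
    rewrite /n !ge_max !lexx.
    have [ab|ba] := leP `|z.1.1 - t0| `|z.1.2 - s0|.
      have [bc|/ltW ->] := leP `|z.1.2 - s0| `|z.2 - x0|; last by rewrite orbT.
      by rewrite (le_trans ab bc) !orbT.
    have [ac|/ltW ->] := leP `|z.1.1 - t0| `|z.2 - x0|; last by rewrite (ltW ba).
    by rewrite (le_trans (ltW ba) ac) !orbT.
  by move=> /or3P[] /(Se z _ n0); lra.
do 4 eexists; split.
- split; first exact: B.
  apply: (convex_growth2 (fun z => ka z.1.2)) g0b; first by move=> z; exact: ka01.
  apply: (convex_growth2 (fun z => k z.2)) g1b; first by move=> z; exact: k01.
  apply: growth2_add; apply: growth2_add.
  + exact: (growth2_t _ (C1_on_continuous _ _ (C1_on_quad R _ 0 0 0))).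
  + exact: (growth2_t _ (C1_on_continuous _ _ (CA pt t0))).
  + exact: (growth2_s _ (C1_on_continuous _ _ (CA ps s0))).
  + pose M := (`|px| + 2 * K) * (1 + `|x0|).
    apply: (growth2_x (fun x => 0 + px * (x - x0) + 0 * (x - x0) ^+ 2 + sg (x - x0)) M).
      by rewrite mulr_ge0// addr_ge0// mulr_ge0.
    move=> x; rewrite add0r mul0r addr0.
    have /andP[Sx0 Sx] := SK (x - x0).
    have pM : 0 <= `|px| + 2 * K by rewrite addr_ge0// mulr_ge0.
    apply: (@le_trans _ _ ((`|px| + 2 * K) * `|x - x0|)).
      by rewrite (le_trans (ler_normD _ _))// normrM (ger0_norm Sx0) mulrDl lerD2l.
    rewrite /M -mulrA ler_wpM2l//.
    have x2 : `|x| <= 1 + x ^+ 2 by rewrite -(real_normK (num_real x)); nra.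
    have := ler_normB x x0; have := normr_ge0 x0; have := sqr_ge0 x; nra.
- move=> z; apply: le_convex; [exact: ka01| |exact: ub0].
  by apply: le_convex; [exact: k01|exact: uPhi|exact: ub1].
- split=> /=.
  + rewrite kas0 kx0 !subrr S0. ring.
  + rewrite kas0 kx0 !subrr dS0. ring.
  + rewrite kas0 kx0 dkas0 !subrr dS0. ring.
  + rewrite kas0 kx0 dkx0 !subrr dS0. ring.
- move=> x /=; rewrite kas0 mul1r subrr mul0r addr0 !subrr S0.
  have /andP[Sx0 Sx] := SK (x - x0).
  have := uL t0 s0 x t0 s0 x0; rewrite !subrr normr0 !add0r ler_norml => /andP[ux _].
  have px1 : px * (x - x0) <= `|px| * `|x - x0| by rewrite (le_trans (ler_norm _))// normrM.
  have /andP[k0 k1] := k01 x.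
  have kC : k x * (C * `|x - x0|) <= eta / 2.
    rewrite mulrCA (@le_trans _ _ (C * (eta / 2 / (C + 1))))// ?ler_wpM2l//.
    by rewrite mulrA ler_pdivrMr ?ltr_wpDl// mulrC ler_wpM2l ?lerDl// ltW// divr_gt0.
  have := b1u x => b1x_.
  have PhiC : u (t0, s0, x0) + px * (x - x0) + sg (x - x0) <= u (t0, s0, x) + C * `|x - x0|.
    by rewrite /C; lra.
  rewrite !mul0r !mulr0 !addr0 !add0r.
  set X := `|x - x0| in kC PhiC *.
  have : k x * (u (t0, s0, x0) + px * (x - x0) + sg (x - x0)) <= k x * (u (t0, s0, x) + C * X).
    by rewrite ler_wpM2l.
  have : (1 - k x) * b1 (t0, s0, x) <= (1 - k x) * (u (t0, s0, x) + eta / 2).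
    by rewrite ler_wpM2l//; lra.
  have : k x * eta >= 0 by rewrite mulr_ge0// ltW.
  by lra.
- by move=> x /=; rewrite ka0 mul0r add0r subr0 mul1r.
Qed.
End touching.

(** * Comparison of the generators at a pair of points *)

Section generator_comparison.
Context {R : realType} (nu : probability R R)
  (nu2 : nu.-integrable setT (fun y => (y ^+ 2)%:E)).

(** Here the second moment of Y enters: quadratic growth together with
    [(C + |y|)^2 <= 2 C^2 + 2 y^2] gives an integrable bound. *)
Lemma slice_integrable (f : point3 R -> R) (t s C : R) (r : R -> R) (A : set R) :
  continuous f -> growth2 f -> measurable_fun setT r -> 0 <= C ->
  (forall y, `|r y| <= C + `|y|) -> measurable A ->
  nu.-integrable A (fun y => (f (t, s, r y))%:E).
Proof.
move=> cf gf mr C0 rC mA.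
have [K K0 fK] := gf (`|t| + `|s|).
have intG : nu.-integrable setT
    (fun y => ((K * (1 + 2 * C ^+ 2))%:E + (2 * K)%:E * (y ^+ 2)%:E)%E).
  apply: integrableD => //; last exact: integrableZl.
  exact: (finite_measure_integrable_cst nu).
apply: (integrableS measurableT) => //.
apply: le_integrable intG => //.
  apply/measurable_EFinP; apply: (measurableT_comp (f := fun x => f (t, s, x))) => //.
  apply: continuous_measurable_fun => x.
  apply: (@continuous_comp _ _ _ (fun x => (t, s, x) : point3 R) f); last exact: cf.
  apply: (@cvg_pair _ _ _ (nbhs x) (nbhs (t, s)) (nbhs x) _ _ _ (fun=> (t, s)) id).
    exact: cvg_cst.
  exact: cvg_id.
move=> y _; rewrite -EFinM -EFinD !abse_EFin lee_fin.
have := fK t s (r y); rewrite lerDl lerDr !normr_ge0 => /(_ isT isT).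
move/le_trans; apply; rewrite (le_trans _ (ler_norm _))//.
have ry2 : r y ^+ 2 <= (C + `|y|) ^+ 2.
  by rewrite -(real_normK (num_real (r y))) lerXn2r ?nnegrE ?addr_ge0.
have y2 : `|y| ^+ 2 = y ^+ 2 by rewrite real_normK// num_real.
have : r y ^+ 2 <= 2 * C ^+ 2 + 2 * y ^+ 2.
  apply: (le_trans ry2); rewrite -y2; have := sqr_ge0 (C - `|y|); nra.
by move=> ?; nra.
Qed.

Lemma Rintegral_sub_le (f g : R -> R) (A : set R) (M : R) : measurable A ->
  nu.-integrable A (EFin \o f) -> nu.-integrable A (EFin \o g) ->
  (forall y, A y -> f y - g y <= M) ->
  \int[nu]_(y in A) f y - \int[nu]_(y in A) g y <= M * fine (nu A).
Proof.
move=> mA intf intg fgM.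
have intM : nu.-integrable A (EFin \o cst M) by exact: (finite_measure_integrable_cst nu).
rewrite -RintegralB// -(Rintegral_cst nu mA); apply: le_Rintegral => //.
by have := integrableB mA intf intg; apply: eq_integrable => //.
Qed.

(** With the same [b] on both sides the integrals run over the same disjoint sets, of total mass at
    most 1, so together they contribute at most [lam * M]. With the same [s] both drifts are
    [c - pi i s (m i)]. The retained amount is merely one particular shift in the bound on the line
    [s = 0]. *)
Lemma generator_sub_le (lam c : R) (pi : regime -> R -> R -> R) (m : regime -> R)
    (psi phi : regime -> point3 R -> R) (i : regime) (b t t' s x x' M : R) :
  0 <= lam -> 0 <= b -> 0 <= M ->
  (forall j, continuous (psi j) /\ growth2 (psi j)) ->
  (forall j, continuous (phi j) /\ growth2 (phi j)) ->
  (forall y, psi i (t, s, x - y) - phi i (t', s, x' - y) <= M) ->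
  (forall y, psi regime2 (t, 0, x - y) - phi regime2 (t', 0, x' - y) <= M) ->
  generator nu lam c pi m b psi i (t, s, x) - generator nu lam c pi m b phi i (t', s, x') <=
    ('D_e_t (psi i) (t, s, x) + 'D_e_s (psi i) (t, s, x) +
      (c - pi i s (m i)) * 'D_e_x (psi i) (t, s, x))
    - ('D_e_t (phi i) (t', s, x') + 'D_e_s (phi i) (t', s, x') +
      (c - pi i s (m i)) * 'D_e_x (phi i) (t', s, x'))
    + lam * M - lam * (psi i (t, s, x) - phi i (t', s, x')).
Proof.
move=> lam0 b0 M0 Hpsi Hphi le1 le2.
have mr a : measurable_fun setT (fun y : R => a - y).
  by apply: measurable_funB => //; exact: measurable_cst.
have mr' a : measurable_fun setT (fun y : R => a - retention y (m i)).
  by apply: measurable_funB => //; apply: measurable_minr => //; exact: measurable_cst.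
have rC (a y : R) : `|a - y| <= `|a| + `|y| by exact: ler_normB.
have rC' (a y : R) : `|a - retention y (m i)| <= (`|a| + `|m i|) + `|y|.
  rewrite (le_trans (ler_normB _ _))// -addrA lerD2l /retention minEle.
  by case: ifP => _; rewrite ?lerDl ?lerDr.
have I1 (v : regime -> point3 R -> R) a a' (A : set R) :
    (forall j, continuous (v j) /\ growth2 (v j)) -> measurable A ->
    nu.-integrable A (EFin \o (fun y => v i (a, s, a' - y))).
  move=> Hv mA; have [cv gv] := Hv i.
  by apply: (slice_integrable _ a s `|a'|).
have I2 (v : regime -> point3 R -> R) a a' (A : set R) :
    (forall j, continuous (v j) /\ growth2 (v j)) -> measurable A ->
    nu.-integrable A (EFin \o (fun y => v regime2 (a, 0, a' - retention y (m i)))).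
  move=> Hv mA; have [cv gv] := Hv regime2.
  by apply: (slice_integrable _ a 0 (`|a'| + `|m i|)) => //; rewrite addr_ge0.
pose A : set R := [set` `]0%R, b]]; pose B : set R := [set` `]b, +oo[].
have mA : measurable A by exact: measurable_itv.
have mB : measurable B by exact: measurable_itv.
have LA := Rintegral_sub_le _ _ A M mA (I1 psi t x A Hpsi mA) (I1 phi t' x' A Hphi mA)
  (fun y _ => le1 y).
have LB := Rintegral_sub_le _ _ B M mB (I2 psi t x B Hpsi mB) (I2 phi t' x' B Hphi mB)
  (fun y _ => le2 _).
have nuAB : fine (nu A) + fine (nu B) <= 1.
  rewrite -fineD ?fin_num_measure// -measureU//; last first.
    apply/seteqP; split => // y []; rewrite /A /B/= !in_itv/= andbT => /andP[_ yb] by_.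
    by rewrite ltNge yb in by_.
  by rewrite -lee_fin fineK ?fin_num_measure ?probability_le1//; exact: measurableU.
have {}nuAB : M * fine (nu A) + M * fine (nu B) <= M.
  by rewrite -mulrDr -[leRHS]mulr1 ler_wpM2l.
rewrite /generator -/A -/B.
set iA := \int[nu]_(y in A) psi i _ in LA *; set iA' := \int[nu]_(y in A) phi i _ in LA *.
set iB := \int[nu]_(y in B) psi _ _ in LB *; set iB' := \int[nu]_(y in B) phi _ _ in LB *.
move: iA iA' iB iB' LA LB => iA iA' iB iB' LA LB.
have lamM : lam * ((iA - iA') + (iB - iB')) <= lam * M by rewrite ler_wpM2l//; lra.
have E (p q w w' : R) : p + lam * iA + lam * iB - lam * w
  - (q + lam * iA' + lam * iB' - lam * w') <= p - q + lam * M - lam * (w - w') by lra.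
exact: E.
Qed.
End generator_comparison.

(** * Test pairs for the coupled system *)

Section touching_pair.
Context {R : realType}.
Implicit Types (u v psi : regime -> point3 R -> R).

Definition smooth_pair psi := forall j,
  (exists ft fs fx, C1_grad (psi j) ft fs fx) /\ growth2 (psi j).

Lemma smooth_pair_test (T S : R) psi : smooth_pair psi -> test_pair T S psi.
Proof.
move=> Hpsi j; have [[ft [fs [fx C]]] gf] := Hpsi j; split; first exact: C1_grad_C1 C.
have [K K0 fK] := gf T; exists K => t s x [/andP[t0 tT] _ /andP[s0 st]].
by apply: fK; rewrite ger0_norm// (le_trans st).
Qed.

Lemma smooth_pair_opp psi : smooth_pair psi -> smooth_pair (fun j z => - psi j z).
Proof.
move=> Hpsi j; have [[ft [fs [fx C]]] gf] := Hpsi j; split.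
  by do 3 eexists; exact: C1_grad_opp C.
move=> B; have [K K0 fK] := gf B; exists K => // t s x tB sB.
by rewrite normrN fK.
Qed.

Lemma smooth_pair_continuous psi : smooth_pair psi ->
  forall j, continuous (psi j) /\ growth2 (psi j).
Proof. by move=> Hpsi j; have [[ft [fs [fx [? _ _]]]] ?] := Hpsi j. Qed.

(** Only component [i] has to touch, while the second component must be sharp at [s = 0]. For
    [i = regime2] one function has to do both, which is why [touching_function] controls two lines
    at once. *)
Lemma touching_pair L u (i : regime) (t0 s0 x0 pt ps px eta : R) :
  (forall j, lip3 L (u j)) -> 0 < s0 -> superjet (u i) t0 s0 x0 pt ps px -> 0 < eta ->
  exists psi, [/\ smooth_pair psi, forall j z, u j z <= psi j z,
    [/\ psi i (t0, s0, x0) = u i (t0, s0, x0), 'D_e_t (psi i) (t0, s0, x0) = pt,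
        'D_e_s (psi i) (t0, s0, x0) = ps & 'D_e_x (psi i) (t0, s0, x0) = px],
    forall x, psi i (t0, s0, x) <= u i (t0, s0, x) + eta &
    forall x, psi regime2 (t0, 0, x) <= u regime2 (t0, 0, x) + eta].
Proof.
move=> uL s00 ju eta0.
have [f [ft [fs [fx [[Cf gf] uf [f0 <- <- <-] fu fu0]]]]] :=
  touching_function L (u i) t0 s0 x0 pt ps px eta (uL i) s00 ju eta0.
have [g1 [g1t [g1s [g1x [Cg1 gg1 ug1 _]]]]] := smooth_majorant L _ t0 0 eta (uL regime1) eta0.
have [g2 [g2t [g2s [g2x [Cg2 gg2 ug2 g2u]]]]] := smooth_majorant L _ t0 0 eta (uL regime2) eta0.
have [_ _ /(_ (t0, s0, x0))[dt ds dx]] := Cf.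
case: i f0 uf fu fu0 {ju} => f0 uf fu fu0.
- exists (fun j => if j is regime1 then f else g2); split.
  + by case; (split; [do 3 eexists; eassumption|]).
  + by case.
  + by rewrite !derive_val.
  + by [].
  + by [].
- exists (fun j => if j is regime1 then g1 else f); split.
  + by case; (split; [do 3 eexists; eassumption|]).
  + by case.
  + by rewrite !derive_val.
  + by [].
  + by [].
Qed.
End touching_pair.

(* The supersolution inequality holds for every [b], in particular for the
   almost optimal one of the subsolution, where the integrals can be compared. *)
Lemma viscosity_comparison_at (R : realType) (nu : probability R R)
    (nu2 : nu.-integrable setT (fun y => (y ^+ 2)%:E))
    (T S lam c L : R) (m : regime -> R) (pi : regime -> R -> R -> R)
    (vsub vsup u v : regime -> point3 R -> R) (i : regime)
    (s tu xu tv xv pt ps px qt qs qx M : R) :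
  0 <= lam ->
  viscosity_subsolution T S nu lam c pi m vsub ->
  viscosity_supersolution T S nu lam c pi m vsup ->
  (forall j, lip3 L (u j)) -> (forall j, lip3 L (v j)) ->
  (forall j z, Dom T S j z -> u j z = vsub j z) ->
  (forall j z, Dom T S j z -> v j z = - vsup j z) ->
  0 < s -> active T S i (tu, s, xu) -> active T S i (tv, s, xv) ->
  superjet (u i) tu s xu pt ps px -> superjet (v i) tv s xv qt qs qx ->
  0 <= M ->
  (forall y, u i (tu, s, xu - y) + v i (tv, s, xv - y) <= M) ->
  (forall y, u regime2 (tu, 0, xu - y) + v regime2 (tv, 0, xv - y) <= M) ->
  lam * (u i (tu, s, xu) + v i (tv, s, xv)) <=
    (pt + ps + (c - pi i s (m i)) * px) + (qt + qs + (c - pi i s (m i)) * qx) + lam * M.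
Proof.
move=> lam0 [_ vsubP] [_ vsupP] uL vL uE vE s0 actu actv ju jv M0 le1 le2.
apply/ler_addgt0Pr => eta eta0.
(* One [ep] is lost in choosing an almost optimal [b], and [2 * ep] under the factor [lam] in
   replacing [u] and [v] by their majorants. *)
pose ep := eta / (1 + 2 * lam).
have l1 : 0 < 1 + 2 * lam by rewrite ltr_pwDl// mulr_ge0.
have ep0 : 0 < ep by rewrite divr_gt0.
have epE : ep * (1 + 2 * lam) = eta by rewrite /ep divfK// gt_eqF.
have [psi [Spsi upsi [psi0 psit psis psix] psi1 psi2]] :=
  touching_pair L u i tu s xu pt ps px ep uL s0 ju ep0.
have [chi [Schi vchi [chi0 chit chis chix] chi1 chi2]] :=
  touching_pair L v i tv s xv qt qs qx ep vL s0 jv ep0.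
(* As [v] extends minus the supersolution, a majorant of [v] becomes after negation a minorant of
   the supersolution. *)
pose phi j z := - chi j z.
have Sphi : smooth_pair phi by exact: smooth_pair_opp.
have Domu : Dom T S i (tu, s, xu) by case: actu.
have Domv : Dom T S i (tv, s, xv) by case: actv.
have sup0 : (0 <= sup_generator nu lam c pi m psi i (tu, s, xu))%E.
  apply: vsubP => //; first exact: smooth_pair_test.
  - by move=> j w Dw; rewrite -uE.
  - by rewrite psi0 uE.
have [b b0 genpsi] : exists2 b, 0 <= b & - ep <= generator nu lam c pi m b psi i (tu, s, xu).
  apply: contrapT => nex; move: sup0; apply/negP; rewrite -ltNge.
  apply: (@le_lt_trans _ _ (- ep)%:E); last by rewrite lte_fin oppr_lt0.
  apply: ge_ereal_sup => _ [b b0 <-]; rewrite lee_fin leNgt; apply/negP => gb.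
  by apply: nex; exists b => //; exact: ltW.
have genphi : generator nu lam c pi m b phi i (tv, s, xv) <= 0.
  have : (sup_generator nu lam c pi m phi i (tv, s, xv) <= 0)%E.
    apply: vsupP => //; first exact: smooth_pair_test.
    - by move=> j w Dw; rewrite /phi lerNl -vE.
    - by rewrite /phi chi0 vE// opprK.
  by rewrite -lee_fin; apply: le_trans; apply: ereal_sup_ubound; exists b.
have Me0 : 0 <= M + 2 * ep by rewrite addr_ge0// mulr_ge0// ltW.
have [Cpsi Cphi] := (smooth_pair_continuous _ Spsi, smooth_pair_continuous _ Sphi).
have G1 y : psi i (tu, s, xu - y) - phi i (tv, s, xv - y) <= M + 2 * ep.
  rewrite /phi opprK (le_trans (lerD (psi1 _) (chi1 _)))//.
  by rewrite addrACA -mulr2n -[ep *+ 2]mulr_natl lerD2r.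
have G2 y : psi regime2 (tu, 0, xu - y) - phi regime2 (tv, 0, xv - y) <= M + 2 * ep.
  rewrite /phi opprK (le_trans (lerD (psi2 _) (chi2 _)))//.
  by rewrite addrACA -mulr2n -[ep *+ 2]mulr_natl lerD2r.
have := generator_sub_le nu nu2 lam c pi m psi phi i b tu tv s xu xv _ lam0 b0 Me0
  Cpsi Cphi G1 G2.
have DN e : (exists d, is_derive (tv, s, xv) e (chi i) d) ->
    'D_e (phi i) (tv, s, xv) = - 'D_e (chi i) (tv, s, xv).
  by move=> [d Dd]; rewrite /phi deriveN.
have [[ft [fs [fx [_ _ /(_ (tv, s, xv))[dt ds dx]]]]] _] := Schi i.
rewrite !DN; [|by eexists; exact: dx|by eexists; exact: ds|by eexists; exact: dt].
rewrite psit psis psix chit chis chix psi0 /phi chi0.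
have arith (g1 g2 p q w e : R) : - e <= g1 -> g2 <= 0 -> g1 - g2 <= p - q +
    lam * (M + 2 * e) - lam * w -> lam * w <= p - q + lam * M + e * (1 + 2 * lam).
  by clear; lra.
move=> /(arith _ _ _ _ _ _ genpsi genphi); rewrite epE opprK.
by move/le_trans; apply; rewrite lerD2r lerD2r; clear; lra.
Qed.

(** * Partial sup-convolution along a characteristic *)

Section sup_convolution.
Context {R : realType} (u : point3 R -> R) (L : R) (uL : lip3 L u)
  (xi : R -> R) (C : R) (xiC : lip C xi) (k eps : R) (eps0 : 0 < eps).

(** Maximizing over the offset [h] from the characteristic keeps the penalty independent of [s], so
    [F] is Lipschitz in [s] uniformly in [h], and so is its maximum. *)
Let F (s : R) (h : R * R) : R :=
  u (k + s + h.1, s, xi s + h.2) - (h.1 ^+ 2 + h.2 ^+ 2) / eps.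

Let F_continuous s : continuous (F s).
Proof.
have L0 := lip3_ge0 _ _ uL.
move=> h; apply: cvgB.
  apply/cvgrPdist_le => /= e e0.
  have d0 : 0 < e / (2 * L + 1) by rewrite divr_gt0// ltr_wpDl// mulr_ge0.
  apply: filterS (nbhsx_ballx h _ d0) => h' [/ltW h1 /ltW h2].
  apply: (le_trans (uL _ _ _ _ _ _)).
  rewrite (_ : k + s + h.1 - (k + s + h'.1) = h.1 - h'.1); last by ring.
  rewrite (_ : xi s + h.2 - (xi s + h'.2) = h.2 - h'.2); last by ring.
  rewrite subrr normr0 addr0.
  apply: (@le_trans _ _ (L * (e / (2 * L + 1) + e / (2 * L + 1)))).
    by rewrite ler_wpM2l// lerD.
  have -> : L * (e / (2 * L + 1) + e / (2 * L + 1)) = 2 * L * e / (2 * L + 1) by ring.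
  by rewrite ler_pdivrMr ?ltr_wpDl ?mulr_ge0// mulrC ler_pM2l// lerDl.
apply: cvgM; last exact: cvg_cst.
by rewrite !expr2; apply: cvgD; apply: cvgM; by [exact: cvg_fst|exact: cvg_snd].
Qed.

Let F_near0 s h : F s 0 <= F s h -> `|h.1| <= 2 * L * eps /\ `|h.2| <= 2 * L * eps.
Proof.
have L0 := lip3_ge0 _ _ uL.
rewrite /F /= expr0n/= !addr0 mul0r subr0.
have := uL (k + s + h.1) s (xi s + h.2) (k + s) s (xi s).
rewrite (_ : k + s + h.1 - (k + s) = h.1); last by ring.
rewrite (_ : xi s + h.2 - xi s = h.2); last by ring.
rewrite subrr normr0 addr0 ler_norml => /andP[_ uh] Fh.
have {uh Fh} : (h.1 ^+ 2 + h.2 ^+ 2) / eps <= L * (`|h.1| + `|h.2|) by lra.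
rewrite ler_pdivrMr// -(real_normK (num_real h.1)) -(real_normK (num_real h.2)).
move: `|h.1| (normr_ge0 h.1) `|h.2| (normr_ge0 h.2) => a a0 b b0 ab.
have Le0 : 0 <= L * eps by rewrite mulr_ge0// ltW.
have {}ab : a ^+ 2 + b ^+ 2 <= L * eps * (a + b) by lra.
rewrite -mulrA; move: (L * eps) Le0 ab => q q0 ab.
(* The hypothesis describes the disc with centre [(q / 2, q / 2)] and radius [q / sqrt 2], on which
   both coordinates stay below [2 q]. *)
suff half (a' b' : R) : a' ^+ 2 + b' ^+ 2 <= q * (a' + b') -> a' <= 2 * q.
  by split; [exact: (half a b)|apply: (half b a); rewrite addrC [b + a]addrC].
move=> ab'; rewrite leNgt; apply/negP => qa.
have a2 : 0 < a' - 2 * q by rewrite subr_gt0.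
have := sqr_ge0 (b' - q / 2); have := mulr_gt0 a2 a2; have := mulr_ge0 q0 (ltW a2).
by have := sqr_ge0 q; lra.
Qed.

(** Outside the square of half-width [2 L eps] the value is below the one at 0, so the maximum over
    this compact square is global. *)
Let F_max s : exists h, forall h', F s h' <= F s h.
Proof.
have L0 := lip3_ge0 _ _ uL.
pose B := 2 * L * eps; have B0 : 0 <= B by rewrite !mulr_ge0// ltW.
have cB : compact ([set` `[- B, B]] `*` [set` `[- B, B]] : set (R * R)).
  by apply: compact_setX; exact: segment_compact.
have [|h _ hmax] := compact_EVT_max _ cB (continuous_subspaceT (F_continuous s)).
  by exists (0, 0); rewrite /= !in_itv/=; split; lra.
exists h => h'; have h0 : F s 0 <= F s h.
  by apply: hmax; rewrite inE/= !in_itv/=; split; lra.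
have [/F_near0[h1 h2]|/ltW/le_trans] := leP (F s 0) (F s h'); last exact.
by apply: hmax; rewrite inE/= !in_itv/= -!ler_norml.
Qed.

(** Moving [s] by a unit moves the base point by 1 in [t], 1 in [s] and at most [C] in [x], hence
    the constant [L (2 + C)]. The gap [4 L^2 eps] is [L] times the size of the optimal offset. *)
Lemma sup_convolution : exists U : R -> R,
  [/\ lip (L * (2 + C)) U,
   forall s, u (k + s, s, xi s) <= U s <= u (k + s, s, xi s) + 4 * L ^+ 2 * eps,
   forall s t x, u (t, s, x) <= U s + ((t - (k + s)) ^+ 2 + (x - xi s) ^+ 2) / eps &
   forall s, exists t x,
     [/\ U s = u (t, s, x) - ((t - (k + s)) ^+ 2 + (x - xi s) ^+ 2) / eps,
         `|t - (k + s)| <= 2 * L * eps & `|x - xi s| <= 2 * L * eps]].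
Proof.
have L0 := lip3_ge0 _ _ uL.
have [H Hmax] := choice F_max.
have near s := F_near0 s (H s) (Hmax s 0).
exists (fun s => F s (H s)); split.
- have half s s' : F s (H s) - F s' (H s') <= L * (2 + C) * `|s - s'|.
    have := Hmax s' (H s); rewrite /F.
    have := uL (k + s + (H s).1) s (xi s + (H s).2) (k + s' + (H s).1) s' (xi s' + (H s).2).
    rewrite (_ : k + s + (H s).1 - (k + s' + (H s).1) = s - s'); last by ring.
    rewrite (_ : xi s + (H s).2 - (xi s' + (H s).2) = xi s - xi s'); last by ring.
    have : L * `|xi s - xi s'| <= L * (C * `|s - s'|) by rewrite ler_wpM2l.
    by move=> Lxi; rewrite ler_norml => /andP[_ uu] FF; lra.
  move=> s s'; rewrite ler_norml half andbT lerNl opprB.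
  by rewrite [`|s - s'|]distrC half.
- move=> s; have [h1 h2] := near s; apply/andP; split.
    have := Hmax s 0; rewrite {1}/F /= expr0n/= !addr0 mul0r subr0.
    exact.
  have := uL (k + s + (H s).1) s (xi s + (H s).2) (k + s) s (xi s).
  rewrite (_ : k + s + (H s).1 - (k + s) = (H s).1); last by ring.
  rewrite (_ : xi s + (H s).2 - xi s = (H s).2); last by ring.
  rewrite subrr normr0 addr0 ler_norml => /andP[_ uh].
  have : L * (`|(H s).1| + `|(H s).2|) <= L * (4 * L * eps) by rewrite ler_wpM2l//; lra.
  have : 0 <= ((H s).1 ^+ 2 + (H s).2 ^+ 2) / eps.
    by rewrite divr_ge0 ?addr_ge0 ?sqr_ge0// ltW.
  by rewrite /F; lra.
- move=> s t x; have := Hmax s (t - (k + s), x - xi s).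
  rewrite {1}/F /= (_ : k + s + (t - (k + s)) = t); last by ring.
  by rewrite (_ : xi s + (x - xi s) = x); [lra|ring].
- move=> s; exists (k + s + (H s).1), (xi s + (H s).2).
  have [h1 h2] := near s.
  rewrite (_ : k + s + (H s).1 - (k + s) = (H s).1); last by ring.
  by rewrite (_ : xi s + (H s).2 - xi s = (H s).2); last by ring.
Qed.
End sup_convolution.

Lemma is_derive_littleo (R : realType) (f : R -> R) (s d eta : R) :
  is_derive s 1 f d -> 0 < eta -> exists2 delta : R, 0 < delta &
    forall s', `|s' - s| <= delta -> `|f s' - f s - d * (s' - s)| <= eta * `|s' - s|.
Proof.
move=> [df dE] eta0.
have : h^-1 *: ((f \o shift s) (h *: 1) - f s) @[h --> 0^'] --> d by rewrite -dE; exact: df.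
move=> /cvgrPdist_le/(_ _ eta0)/nbhs_ballP[dl /= dl0 H].
exists (dl / 2) => [|s' s'd]; first by rewrite divr_gt0.
have [->|ss] := eqVneq s' s; first by rewrite !subrr mulr0 subrr normr0 mulr0.
have ss0 : s' - s != 0 by rewrite subr_eq0.
have := H (s' - s); rewrite /ball/= sub0r normrN.
rewrite (le_lt_trans s'd) ?ltr_pdivrMr ?ltr_pMr ?ltr1n// => /(_ isT ss0).
rewrite /GRing.scale/= mulr1 subrK => Hs.
have -> : f s' - f s - d * (s' - s) = (s' - s) * - (d - (s' - s)^-1 * (f s' - f s)).
  by field.
by rewrite normrM normrN mulrC ler_wpM2r.
Qed.

(** Above [u] lies [U s] plus the penalty, with equality at the maximizer, and this majorant has a
    first-order expansion wherever [U] and [xi] do. Its slopes in [t] and [x] are those of the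
    penalty; the moving centre subtracts [pt + a * px] in [s], so that along [(1, 1, a)] only [D]
    survives. *)
Lemma sup_convolution_superjet (R : realType) (u : point3 R -> R) (U xi : R -> R)
    (C k eps s a D t0 x0 : R) :
  0 < eps -> lip C xi -> is_derive s 1 U D -> is_derive s 1 xi a ->
  (forall s t x, u (t, s, x) <= U s + ((t - (k + s)) ^+ 2 + (x - xi s) ^+ 2) / eps) ->
  U s = u (t0, s, x0) - ((t0 - (k + s)) ^+ 2 + (x0 - xi s) ^+ 2) / eps ->
  exists pt px, superjet u t0 s x0 pt (D - pt - a * px) px.
Proof.
move=> eps0 xiC dU dxi uU Us; have C0 := lip_ge0 _ _ _ xiC.
pose A := t0 - (k + s); pose B := x0 - xi s; pose w := eps^-1.
have w0 : 0 < w by rewrite invr_gt0.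
exists (2 * A * w), (2 * B * w) => eta eta0.
(* [N] collects the first-order errors of [U] and [xi], [K] the second-order terms of the penalty;
   each group receives half of [eta]. *)
pose N := 1 + 2 * `|B| * w; have N0 : 0 < N.
  by rewrite ltr_wpDr// mulr_ge0 ?(ltW w0)// mulr_ge0.
pose K := (4 + (1 + C) ^+ 2) * w; have K0 : 0 < K.
  by rewrite mulr_gt0// ltr_wpDr// sqr_ge0.
pose e1 := eta / 2 / N; have e10 : 0 < e1 by rewrite !divr_gt0.
have e1N : e1 * N = eta / 2 by rewrite /e1 divfK// gt_eqF.
have [d1 d10 oU] := is_derive_littleo _ _ _ _ _ dU e10.
have [d2 d20 oxi] := is_derive_littleo _ _ _ _ _ dxi e10.
pose d3 := eta / 2 / K; have d30 : 0 < d3 by exact: divr_gt0 (divr_gt0 eta0 (ltr0n _ 2)) K0.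
exists (Num.min d1 (Num.min d2 d3)); first by rewrite !lt_min d10 d20.
move=> t s' x r; set dt := t - t0; set ds := s' - s; set dx := x - x0 => dtr dsr dxr.
rewrite !le_min => /and3P[rd1 rd2 rd3].
have r0 : 0 <= r by exact: le_trans dtr.
have Kr : K * r <= eta / 2.
  by rewrite -(ler_pM2l K0) /d3 mulrCA divff ?gt_eqF// mulr1 in rd3.
have /ler_normlP[_ hU] := oU s' (le_trans dsr rd1).
have hxi := oxi s' (le_trans dsr rd2).
have Lxi := xiC s' s.
rewrite -/ds in hU hxi Lxi; pose rho := xi s' - xi s - a * ds.
have rho_r : `|rho| <= e1 * r by rewrite (le_trans hxi)// ler_wpM2l// ltW.
have {}hU : U s' - U s - D * ds <= e1 * r.
  by rewrite (le_trans hU)// ler_wpM2l// ltW.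
pose dx' := xi s' - xi s.
have dxC : `|dx'| <= C * r by rewrite (le_trans Lxi)// ler_wpM2l.
have sq1 : (t - (k + s')) ^+ 2 <= A ^+ 2 + 2 * A * (dt - ds) + 4 * r ^+ 2.
  have -> : t - (k + s') = A + (dt - ds) by rewrite /A /dt /ds; clear; ring.
  have : (dt - ds) ^+ 2 <= (2 * r) ^+ 2.
    rewrite -(real_normK (num_real (dt - ds))) lerXn2r ?nnegrE ?mulr_ge0//.
    by rewrite (le_trans (ler_normB _ _))// mulr_natl mulr2n lerD.
  by move: (dt - ds); clear=> h; lra.
have sq2 : (x - xi s') ^+ 2 <= B ^+ 2 + 2 * B * (dx - a * ds)
    + 2 * `|B| * (e1 * r) + (1 + C) ^+ 2 * r ^+ 2.
  have -> : x - xi s' = B + (dx - dx') by rewrite /B /dx /dx'; clear; ring.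
  have h1 : (dx - dx') ^+ 2 <= ((1 + C) * r) ^+ 2.
    rewrite -(real_normK (num_real (dx - dx'))) lerXn2r ?nnegrE ?mulr_ge0 ?addr_ge0//.
    by rewrite (le_trans (ler_normB _ _))// mulrDl mul1r lerD.
  have h2 : - (B * rho) <= `|B| * (e1 * r).
    rewrite (@le_trans _ _ `|B * rho|)//; first by rewrite -normrN ler_norm.
    by rewrite normrM ler_wpM2l.
  have rE : rho = dx' - a * ds by rewrite /rho /dx'.
  by rewrite rE in h2; move: (dx') h1 h2; clear=> h h1 h2; lra.
have step : ((t - (k + s')) ^+ 2 + (x - xi s') ^+ 2) * w <=
  ((A ^+ 2 + 2 * A * (dt - ds) + 4 * r ^+ 2) +
  (B ^+ 2 + 2 * B * (dx - a * ds) + 2 * `|B| * (e1 * r) + (1 + C) ^+ 2 * r ^+ 2)) * w.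
  by rewrite ler_pM2r//; exact: lerD.
have rK : r * (K * r) <= r * (eta / 2) by rewrite ler_wpM2l.
have rN : r * (e1 * N) = r * (eta / 2) by rewrite e1N.
have := le_trans (uU s' t x) (_ : _ <= U s' + _); move/(_ _ (lerD (lexx _) step)).
rewrite Us -/A -/B -/w in hU; rewrite /N in rN; rewrite /K in rK.
move: (u (t, s', x)) (u (t0, s, x0)) (U s') hU => ut u0 Us' hU utU.
move: (`|B|) rN utU; clear -hU rK => b rN utU; lra.
Qed.

(** * Extension to the whole space and growth along characteristics *)

Lemma clamp_lip (R : realType) (a b x y : R) :
  `|Num.max a (Num.min x b) - Num.max a (Num.min y b)| <= `|x - y|.
Proof.
wlog xy : x y / x <= y.
  move=> H; have [|/ltW] := leP x y; first exact: H.
  by rewrite distrC [`|x - y|]distrC; exact: H.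
rewrite [`|x - y|]distrC (ger0_norm (_ : 0 <= y - x)) ?subr_ge0// ler_norml.
rewrite !maxEle !minEle; repeat case: ifPn; rewrite -?ltNge => *; lra.
Qed.

(** Clamping to [[a, b]] reduces this to the global case. It is needed for products with
    [exp (- lam s)], which are Lipschitz on bounded intervals only. *)
Lemma lip_itv_ae_derive_ge0 (R : realType) (L : R) (F : R -> R) (a b : R) :
  0 <= L ->
  (forall x y, a <= x <= b -> a <= y <= b -> `|F x - F y| <= L * `|x - y|) ->
  a <= b ->
  {ae lebesgue_measure, forall x : R, a < x < b -> derivable F x 1 -> 0 <= 'D_1 F x} ->
  F a <= F b.
Proof.
move=> L0 FL ab aeF.
pose cl x := Num.max a (Num.min x b).
have clab x : a <= cl x <= b by rewrite /cl le_max lexx/= ge_max ab ge_min lexx orbT.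
have clE x : a <= x <= b -> cl x = x.
  by move=> /andP[ax xb]; rewrite /cl min_l// max_r.
have FclL : lip L (F \o cl).
  move=> x y; apply: (le_trans (FL _ _ (clab x) (clab y))).
  by rewrite ler_wpM2l// clamp_lip.
have := lip_ae_derive_ge0 R L _ a b FclL ab.
rewrite /= !clE ?lexx ?ab//; apply.
apply: filterS aeF; first exact: (ae_filter_ringOfSetsType lebesgue_measure).
move=> x Fx axb; have xab : x \in `]a, b[ by rewrite in_itv.
have nF : {near x, F \o cl =1 F}.
  apply: filterS (near_in_itvoo xab) => y; rewrite in_itv/= => /andP[ay yb].
  by rewrite clE// !ltW.
move=> dFcl; rewrite (near_eq_derive _ nF); exact: Fx axb (near_eq_derivable nF dFcl).
Qed.

Lemma lip3_le (R : realType) (L L' : R) (u : point3 R -> R) :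
  L <= L' -> lip3 L u -> lip3 L' u.
Proof.
by move=> LL uL t s x t' s' x'; rewrite (le_trans (uL _ _ _ _ _ _))// ler_wpM2r//.
Qed.

(** Compose with a retraction onto the domain: clamp [s] to [[0, b]], then [t] between the clamped
    [s] and [T]. Including [T] in [b] keeps that last interval nonempty. *)
Lemma lipschitz_extension (R : realType) (T S : R) (j : regime) (f : point3 R -> R) :
  0 <= T -> 0 <= S -> [lipschitz f z | z in Dom T S j] ->
  exists L F, lip3 L F /\ forall z, Dom T S j z -> F z = f z.
Proof.
move=> T0 S0 /pinfty_ex_gt0[L L0 fL].
pose b := Num.min T (s_bound T S j).
have b0 : 0 <= b by rewrite le_min T0/=; case: (j).
pose ps s := Num.max 0 (Num.min s b).
pose pt t s := Num.max (ps s) (Num.min t T).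
have psb s : 0 <= ps s <= b by rewrite /ps le_max lexx/= ge_max b0 ge_min lexx orbT.
have PD t s x : Dom T S j (pt t s, ps s, x).
  have /andP[p0 pb] := psb s; move: (pb); rewrite le_min => /andP[pT pS].
  split; rewrite ?p0 ?pS//.
    by rewrite ge_max pT ge_min lexx orbT andbT (le_trans p0)// le_max lexx.
  by rewrite /pt le_max lexx.
exists L, (fun z => f (pt z.1.1 z.1.2, ps z.1.2, z.2)); split.
  move=> t s x t' s' x' /=.
  have := fL ((pt t s, ps s, x), (pt t' s', ps s', x')) (conj (PD t s x) (PD t' s' x')).
  move=> /le_trans; apply; rewrite ler_wpM2l ?(ltW L0)//.
  have ds : `|ps s - ps s'| <= `|s - s'| by exact: clamp_lip.
  have dt : `|pt t s - pt t' s'| <= `|t - t'| + `|s - s'|.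
    have : `|Num.min t T - Num.min t' T| <= `|t - t'|.
      rewrite ler_norml !minEle; have := ler_norm (t - t'); have := ler_norm (t' - t).
      rewrite [`|t' - t|]distrC; repeat case: ifPn; rewrite -?ltNge => *; lra.
    move: ds; rewrite /pt; move: (ps s) (ps s') (Num.min t T) (Num.min t' T) => a a' e e'.
    move: (`|t - t'|) (`|s - s'|) => dt ds.
    rewrite !ler_norml !maxEle => /andP[? ?] /andP[? ?].
    by repeat case: ifPn; rewrite -?ltNge => *; lra.
  rewrite !prod_normE/= !ge_max; apply/andP; split; [apply/andP; split|].
  - by rewrite (le_trans dt)// lerDl.
  - by rewrite (le_trans ds)// -addrA addrCA lerDl addr_ge0.
  - by rewrite lerDr addr_ge0.
move=> [[t s] x] [/andP[t0 tT] /andP[s0 sS] /andP[_ st]] /=.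
have -> : ps s = s.
  by rewrite /ps min_l ?max_r// le_min sS (le_trans st).
by rewrite /pt min_l// max_r// /ps min_l ?max_r// le_min sS (le_trans st).
Qed.

Lemma Dom_boundary (R : realType) (T S : R) (j : regime) (t s x : R) :
  Dom T S j (t, s, x) -> [\/ s = 0, s = t, t = T | s = s_bound T S j] ->
  boundary (Dom T S j) (t, s, x).
Proof.
move=> Dz edge; split; first exact: subset_closure.
rewrite /interior /= => /nbhs_ballP[e /= e0 eD].
have e2 : 0 < e / 2 by rewrite divr_gt0.
have ee : e / 2 < e by rewrite ltr_pdivrMr// ltr_pMr// ltr1n.
have near h : `|h| <= e / 2 -> forall h', `|h'| <= e / 2 -> Dom T S j (t + h, s + h', x).
  move=> he h' he'; apply: eD; split; last by apply: ballxx.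
  split; rewrite /ball/= opprD addrA subrr sub0r normrN; exact: le_lt_trans ee.
have z0 : `|0 : R| <= e / 2 by rewrite normr0 ltW.
have p0 : `|e / 2| <= e / 2 by rewrite ger0_norm// ltW.
have m0 : `|- (e / 2)| <= e / 2 by rewrite normrN.
case: edge => E.
- by have [_ /andP[]] := near _ z0 _ m0; rewrite E; lra.
- by have [_ _ /andP[_]] := near _ z0 _ p0; rewrite E; lra.
- by have [/andP[_]] := near _ p0 _ z0; rewrite E; lra.
- by have [_ /andP[_]] := near _ z0 _ p0; rewrite E; lra.
Qed.

Lemma expR_opp_lip (R : realType) (lam a b x y : R) : 0 <= lam -> 0 <= a ->
  a <= x <= b -> a <= y <= b -> `|expR (- lam * x) - expR (- lam * y)| <= lam * `|x - y|.
Proof.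
move=> lam0 a0; wlog xy : x y / x <= y.
  move=> H xab yab; have [xy|/ltW yx] := leP x y; first exact: H.
  by rewrite distrC [`|x - y|]distrC; exact: H.
move=> /andP[ax _] _.
have E : expR (- lam * y) = expR (- lam * x) * expR (- lam * (y - x)).
  by rewrite -expRD; congr expR; ring.
have e1 : expR (- lam * (y - x)) >= 1 - lam * (y - x).
  by rewrite -mulNr expR_ge1Dx.
have yx0 : 0 <= y - x by rewrite subr_ge0.
have e2 : expR (- lam * (y - x)) <= 1.
  by rewrite -expR0 ler_expR mulNr oppr_le0 mulr_ge0.
have e3 : expR (- lam * x) <= 1.
  by rewrite -expR0 ler_expR mulNr oppr_le0 mulr_ge0// (le_trans a0).
have e4 := expR_ge0 (- lam * x).
rewrite E -[X in X - _]mulr1 -mulrBr normrM (ger0_norm e4) ger0_norm ?subr_ge0//.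
rewrite distrC (ger0_norm yx0).
apply: (@le_trans _ _ (1 * (1 - expR (- lam * (y - x))))).
  by rewrite ler_wpM2r// subr_ge0.
by rewrite mul1r lerBlDr addrC -lerBlDr.
Qed.

(* The integrated form of [w' >= lam (w - M)] for [w = u i + v i]; here [v]
   extends the opposite of the supersolution. *)
Lemma characteristic_growth (R : realType) (nu : probability R R)
  (nu2 : nu.-integrable setT (fun y => (y ^+ 2)%:E))
  (T S lam c L C : R) (m : regime -> R) (pi : regime -> R -> R -> R)
  (vsub vsup u v : regime -> point3 R -> R) (i : regime) (xi : R -> R) (M : R)
  (lam0 : 0 <= lam) (M0 : 0 <= M)
  (vsubP : viscosity_subsolution T S nu lam c pi m vsub)
  (vsupP : viscosity_supersolution T S nu lam c pi m vsup)
  (uL : forall j, lip3 L (u j)) (vL : forall j, lip3 L (v j))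
  (uE : forall j z, Dom T S j z -> u j z = vsub j z)
  (vE : forall j z, Dom T S j z -> v j z = - vsup j z)
  (leM : forall z, Dom T S i z -> u i z + v i z <= M)
  (le0 : forall t x, 0 <= t <= T -> u regime2 (t, 0, x) + v regime2 (t, 0, x) <= M)
  (xiC : lip C xi)
  (dxi : {ae lebesgue_measure, forall s : R, 0 < s < T ->
     is_derive s 1 xi (c - pi i s (m i))})
  (k s0 s1 : R) : 0 < k -> 0 < s0 -> s0 <= s1 ->
  k + s1 < T -> s1 < s_bound T S i ->
  expR (- lam * s0) * (u i (k + s0, s0, xi s0) + v i (k + s0, s0, xi s0) - M) <=
  expR (- lam * s1) * (u i (k + s1, s1, xi s1) + v i (k + s1, s1, xi s1) - M).
Proof.
move=> k0 s00 s01 ks1 s1S.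
have L0 : 0 <= L := lip3_ge0 _ _ (uL regime1).
(* A maximizer closer than [r] to the characteristic still satisfies [s < t < T], so the equation is
   imposed there. *)
pose r := Num.min k (T - (k + s1)).
have r0 : 0 < r by rewrite lt_min k0 subr_gt0.
suff H (eps : R) : 0 < eps -> 2 * L * eps < r ->
    expR (- lam * s0) * (u i (k + s0, s0, xi s0) + v i (k + s0, s0, xi s0)
      - (M + 8 * L ^+ 2 * eps)) <=
    expR (- lam * s1) * (u i (k + s1, s1, xi s1) + v i (k + s1, s1, xi s1) - M).
  apply/ler_addgt0Pr => e e0; set w0 := u i _ + _.
  have a0 : 0 < 2 * L + 1 by rewrite ltr_wpDl// mulr_ge0.
  have b0 : 0 < 8 * L ^+ 2 + 1 by rewrite ltr_wpDl// mulr_ge0// sqr_ge0.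
  pose eps := Num.min (r / 2 / (2 * L + 1)) (e / (8 * L ^+ 2 + 1)).
  have eps0 : 0 < eps by rewrite lt_min !divr_gt0.
  have eps1 : 2 * L * eps < r.
    apply: (@le_lt_trans _ _ ((2 * L + 1) * (r / 2 / (2 * L + 1)))).
      by apply: ler_pM; rewrite ?lerDl ?mulr_ge0 ?ge_min ?lexx// ltW.
    by rewrite mulrC divfK ?gt_eqF// ltr_pdivrMr// ltr_pMr// ltr1n.
  have eps2 : 8 * L ^+ 2 * eps <= e.
    apply: (@le_trans _ _ ((8 * L ^+ 2 + 1) * (e / (8 * L ^+ 2 + 1)))).
      by apply: ler_pM; rewrite ?lerDl ?mulr_ge0 ?sqr_ge0 ?ge_min ?lexx ?orbT// ltW.
    by rewrite mulrC divfK ?gt_eqF.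
  have E0 : 0 <= expR (- lam * s0) <= 1.
    by rewrite expR_ge0 -expR0 ler_expR mulNr oppr_le0 mulr_ge0// ltW.
  have eL : expR (- lam * s0) * (8 * L ^+ 2 * eps) <= e.
    apply: le_trans eps2; rewrite ler_piMl//; last by case/andP: E0.
    by rewrite !mulr_ge0 ?sqr_ge0// ltW.
  apply: le_trans (_ : _ <= expR (- lam * s0) * (w0 - (M + 8 * L ^+ 2 * eps)) + e) _.
    by move: (expR _) eL; clear=> *; lra.
  by rewrite lerD2r; exact: H.
move=> eps0 epsr.
have [U [UL Uu uU Umax]] := sup_convolution (u i) L (uL i) xi C xiC k eps eps0.
have [V [VL Vv vV Vmax]] := sup_convolution (v i) L (vL i) xi C xiC k eps eps0.
(* The excess [8 L^2 eps] serves twice: it bounds the gap between [U + V] and [u + v] on the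
   characteristic, and the cost of moving [v] from its own maximizer to that of [u]. *)
pose M' := M + 8 * L ^+ 2 * eps.
have M'0 : 0 <= M' by rewrite addr_ge0// mulr_ge0 ?(ltW eps0)// mulr_ge0// sqr_ge0.
pose G s := expR (- lam * s) * (U s + V s - M').
apply: (@le_trans _ _ (G s0)).
  rewrite /G ler_wpM2l ?expR_ge0// lerD2r; apply: lerD; first by case/andP: (Uu s0).
  by case/andP: (Vv s0).
apply: (@le_trans _ _ (G s1)); last first.
  rewrite /G /M' ler_wpM2l ?expR_ge0//.
  have /andP[_ ] := Uu s1; have /andP[_ ] := Vv s1.
  move: (u i _) (v i _) (U s1) (V s1); clear=> *; lra.
have [K K0 GK] : exists2 K, 0 <= K & forall x y, s0 <= x <= s1 -> s0 <= y <= s1 ->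
    `|G x - G y| <= K * `|x - y|.
  pose g x := U x + V x - M'; pose A := L * (2 + C).
  have C0 := lip_ge0 _ _ _ xiC.
  have A0 : 0 <= A by rewrite mulr_ge0// addr_ge0.
  have gA x y : `|g x - g y| <= 2 * A * `|x - y|.
    have -> : g x - g y = (U x - U y) + (V x - V y) by rewrite /g; ring.
    by rewrite (le_trans (ler_normD _ _))// -mulrA mulr_natl mulr2n lerD.
  pose B := `|g s0| + 2 * A * (s1 - s0).
  have gB y : s0 <= y <= s1 -> `|g y| <= B.
    move=> /andP[y0 y1]; rewrite -lerBlDl (le_trans (lerB_dist _ _))//.
    rewrite (le_trans (gA _ _))// ger0_norm ?subr_ge0// ler_wpM2l ?lerD2r//.
    by rewrite mulr_ge0.
  have B0 : 0 <= B.
    apply: addr_ge0 => //; apply: mulr_ge0; last by rewrite subr_ge0.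
    exact: mulr_ge0.
  exists (2 * A + lam * B).
    by apply: addr_ge0; exact: mulr_ge0.
  move=> x y x01 y01.
  have -> : G x - G y = expR (- lam * x) * (g x - g y)
      + (expR (- lam * x) - expR (- lam * y)) * g y by rewrite /G -/(g x) -/(g y); ring.
  rewrite (le_trans (ler_normD _ _))// !normrM mulrDl lerD//.
    rewrite (ger0_norm (expR_ge0 _)) (le_trans (ler_piMl _ _))//.
    rewrite -expR0 ler_expR mulNr oppr_le0 mulr_ge0//.
    by case/andP: x01 => x0 _; rewrite (le_trans _ x0)// ltW.
  rewrite mulrAC ler_pM//; last exact: gB.
  exact: expR_opp_lip lam0 (ltW s00) x01 y01.
apply: (lip_itv_ae_derive_ge0 R K) => //.
have aeU := lip_ae_derivable R _ U s0 s1 UL.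
have aeV := lip_ae_derivable R _ V s0 s1 VL.
apply: filterS3 aeU aeV dxi; first exact: (ae_filter_ringOfSetsType lebesgue_measure).
move=> s dU dV dx s01s _.
have {dU}/derivableP dU := dU s01s; have {dV}/derivableP dV := dV s01s.
have /andP[s0s ss1] := s01s.
have s0' : 0 < s by exact: lt_trans s0s.
have {dx} dx : is_derive s 1 xi (c - pi i s (m i)).
  by apply: dx; rewrite s0'/= (lt_trans ss1)// (le_lt_trans _ ks1)// lerDr ltW.
set U' := 'D_1 U s in dU; set V' := 'D_1 V s in dV.
have dE : is_derive s 1 (fun s => expR (- lam * s)) (- lam * expR (- lam * s)).
  have D1 : is_derive s 1 (fun x : R => - lam * x) (- lam).
    by apply: is_derive_eq; rewrite /GRing.scale/=; clear; ring.
  by have := @is_derive1_comp _ expR _ s _ _ (is_derive_expR _) D1; rewrite mulrC.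
have dg : is_derive s 1 (fun s => U s + V s - M') (U' + V').
  by apply: is_derive_eq; rewrite subr0.
have -> : 'D_1 G s = expR (- lam * s) * (U' + V' - lam * (U s + V s - M')).
  rewrite (@derive_val _ _ _ _ _ _ _ (is_deriveM dE dg)) /GRing.scale/=.
  by clear; ring.
apply: mulr_ge0; first exact: expR_ge0.
have [tu [xu [Us tus xus]]] := Umax s; have [tv [xv [Vs tvs xvs]]] := Vmax s.
have [pt [px ju]] := sup_convolution_superjet R (u i) U xi C k eps s _ _ tu xu
  eps0 xiC dU dx uU Us.
have [qt [qx jv]] := sup_convolution_superjet R (v i) V xi C k eps s _ _ tv xv
  eps0 xiC dV dx vV Vs.
have time t : `|t - (k + s)| <= 2 * L * eps -> s < t < T.
  move=> /le_lt_trans/(_ epsr); rewrite /r lt_min => /andP[].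
  by rewrite !ltr_norml => /andP[? ?] /andP[? ?]; apply/andP; split; lra.
have DomT t x : s < t < T -> Dom T S i (t, s, x).
  move=> /andP[st tT]; split; apply/andP; split; rewrite ?(ltW s0') ?(ltW st) ?(ltW tT)//.
    by rewrite (le_trans (ltW s0'))// ltW.
  by rewrite ltW// (lt_trans ss1).
have act t x : s < t < T -> active T S i (t, s, x).
  move=> stT; split; [exact: DomT|by case/andP: stT|].
  by move=> i2; move: s1S; rewrite i2; exact: lt_trans.
(* [M] bounds [u + v] at a common point only, so [v] is transported to the maximizer of [u]; the two
   are within [4 L eps] in [t] and in [x]. *)
have shift j s' x : v j (tv, s', xv - x) <= v j (tu, s', xu - x) + 8 * L ^+ 2 * eps.
  have := vL j tv s' (xv - x) tu s' (xu - x).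
  rewrite subrr normr0 addr0 (_ : xv - x - (xu - x) = xv - xu); last by clear; ring.
  move=> /(le_trans (ler_norm _)).
  have dt : `|tv - tu| <= 4 * L * eps.
    rewrite (le_trans (ler_distD (k + s) _ _))// [`|k + s - tu|]distrC.
    by rewrite (le_trans (lerD tvs tus))//; clear; lra.
  have dx' : `|xv - xu| <= 4 * L * eps.
    rewrite (le_trans (ler_distD (xi s) _ _))// [`|xi s - xu|]distrC.
    by rewrite (le_trans (lerD xvs xus))//; clear; lra.
  have := ler_wpM2l L0 (lerD dt dx').
  by move: (v j _) (v j _) (`|tv - tu|) (`|xv - xu|); clear=> *; lra.
have DomA := DomT tu _ (time _ tus).
have key := viscosity_comparison_at R nu nu2 T S lam c L m pi vsub vsup u v i
  s tu xu tv xv _ _ _ _ _ _ M' lam0 vsubP vsupP uL vL uE vE s0'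
  (act _ xu (time _ tus)) (act _ xv (time _ tvs)) ju jv M'0.
have {}key : lam * (U s + V s) <= U' + V' + lam * M'.
  apply: (@le_trans _ _ (lam * (u i (tu, s, xu) + v i (tv, s, xv)))).
    rewrite ler_wpM2l// Us Vs; apply: lerD; rewrite lerBlDr lerDl;
    by rewrite divr_ge0 ?(ltW eps0)// addr_ge0 ?sqr_ge0.
  apply: (le_trans (key _ _)).
  - move=> y; rewrite (le_trans (lerD (lexx _) (shift i s y)))// addrA lerD2r.
    exact: leM.
  - move=> y; rewrite (le_trans (lerD (lexx _) (shift regime2 0 y)))// addrA lerD2r.
    apply: le0; have [/andP[? ?] _ _] := DomA xu; exact/andP.
  - by clear; lra.
rewrite subr_ge0 mulrBr lerBlDr.
by [].
Qed.

(** * From the data of the theorem to the conclusion *)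

Lemma distribution_sqr_integrable (R : realType) (d : measure_display)
    (Omega : measurableType d) (P : probability Omega R) (Y : {RV P >-> R}) :
  ('E_P[(fun w => Y w ^+ 2)%R] < +oo)%E ->
  (distribution P Y).-integrable setT (fun y => (y ^+ 2)%:E).
Proof.
move=> EY.
have my2 : measurable_fun setT (fun y : R => (y ^+ 2)%:E).
  by apply/measurable_EFinP; exact: measurable_funX.
apply/integrableP; split => //.
rewrite (eq_integral (fun y : R => (y ^+ 2)%:E)); last first.
  by move=> y _; rewrite /= ger0_norm// sqr_ge0.
rewrite ge0_integral_distribution//.
- by move: EY; rewrite unlock.
- by move=> y; rewrite lee_fin sqr_ge0.
Qed.

(** Since [0 <= p < c], the speed [c - p] lies between 0 and [c], which makes the characteristics
    Lipschitz. *)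
Lemma premium_primitive (R : realType) (c a T : R) (p : R -> R -> R) :
  0 <= a ->
  measurable_fun (`[0, +oo[ `*` `[0, +oo[ : set (R * R)) (fun q => p q.1 q.2) ->
  (forall s b, 0 <= s -> 0 <= b -> 0 <= p s b) -> (forall s, 0 <= s -> p s a < c) ->
  exists xi, lip `|c| xi /\
    {ae lebesgue_measure, forall s : R, 0 < s < T -> is_derive s 1 xi (c - p s a)}.
Proof.
move=> a0 mp p0 pc; apply: bounded_measurable_primitive => //.
  apply: measurable_funB => //.
  apply: (@measurable_comp _ _ _ _ _ _ (`[0, +oo[ `*` `[0, +oo[ : set (R * R)) (fun q => p q.1 q.2) _ (fun s => (s, a))) => //.
  - exact: measurableX.
  - move=> _ [s /= + <-]; rewrite !in_itv/= !andbT => /andP[s0 _].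
    by split => /=; rewrite ?in_itv/= ?andbT.
  - by apply: measurable_funTS; exact: pair2_measurable.
move=> s /andP[s0 _]; have c0 : 0 < c by exact: le_lt_trans (p0 s a s0 a0) (pc s s0).
rewrite (gtr0_norm c0) ger0_norm ?subr_ge0 ?(ltW (pc _ s0))//.
by rewrite lerBlDr lerDl p0.
Qed.

(** The chain [w0 - M <= E0 (w0 - M) <= E1 (w1 - M) <= Emin (w1 - M) <= Emin (del - M)], whose outer
    steps use that [w0 - M] and [w1 - M] are nonpositive. *)
Lemma contraction_of_growth (R : realType) (E0 E1 Emin w0 w1 M del : R) :
  0 <= E0 <= 1 -> 0 <= Emin -> Emin <= E1 -> w0 <= M -> w1 <= M -> w1 <= del ->
  E0 * (w0 - M) <= E1 * (w1 - M) -> w0 <= M - Emin * M + Emin * del.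
Proof.
move=> /andP[E00 E01] Em EmE wM0 wM1 wd h.
have h1 : 0 <= (1 - E0) * (M - w0) by rewrite mulr_ge0 ?subr_ge0.
have h2 : 0 <= (E1 - Emin) * (M - w1) by rewrite mulr_ge0 ?subr_ge0.
have h3 : Emin * w1 <= Emin * del by rewrite ler_wpM2l.
lra.
Qed.

Theorem theorem4p2 (R : realType)
    (d : measure_display) (Omega : measurableType d) (P : probability Omega R)
    (Y : {RV P >-> R})
    (T S lam c : R) (m : regime -> R) (pi : regime -> R -> R -> R)
    (T_gt0 : 0 < T) (S_gt0 : 0 < S) (lam_gt0 : 0 < lam)
    (m_ge0 : forall i, 0 <= m i)
    (cdf_continuous : continuous (cdf Y))
    (cdf0 : cdf Y 0 = 0%E)
    (EY2_lty : ('E_P[(fun w => Y w ^+ 2)%R] < +oo)%E)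
    (pi_measurable : forall i,
       measurable_fun (`[0, +oo[ `*` `[0, +oo[ : set (R * R))
         (fun q => pi i q.1 q.2))
    (pi_ge0 : forall i (s a : R), 0 <= s -> 0 <= a -> 0 <= pi i s a)
    (pi_lt : forall s : R, 0 <= s -> pi regime1 s (m regime1) < pi regime2 s (m regime2))
    (pi_ltc : forall i (s : R), 0 <= s -> pi i s (m i) < c)
    (vsub vsup : regime -> point3 R -> R)
    (vsub_lipschitz : forall j, [lipschitz vsub j z | z in Dom T S j])
    (vsup_lipschitz : forall j, [lipschitz vsup j z | z in Dom T S j])
    (vsub_sub :
       viscosity_subsolution T S (distribution P Y) lam c pi m vsub)
    (vsup_super :
       viscosity_supersolution T S (distribution P Y) lam c pi m vsup)
    (le_boundary : forall j z, boundary (Dom T S j) z -> vsub j z <= vsup j z) :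
  forall j z, Dom T S j z -> vsub j z <= vsup j z.
Proof.
have nu2 := distribution_sqr_integrable _ _ _ _ _ EY2_lty.
have [T0 S0 l0] : [/\ 0 <= T, 0 <= S & 0 <= lam] by rewrite !ltW.
have extu j := lipschitz_extension R T S j (vsub j) T0 S0 (vsub_lipschitz j).
have lipN j : [lipschitz (fun z => - vsup j z) z | z in Dom T S j].
  have /pinfty_ex_gt0[K K0 HK] := vsup_lipschitz j.
  exists K; split; [exact: num_real|move=> K' /ltW KK' z /HK /= h].
  rewrite opprK addrC distrC (le_trans h)// ler_wpM2r//.
have extv j := lipschitz_extension R T S j (fun z => - vsup j z) T0 S0 (lipN j).
have [Lu /choice[u Hu]] := choice extu; have [Lv /choice[v Hv]] := choice extv.
have Lu0 j : 0 <= Lu j by have [/lip3_ge0] := Hu j.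
have Lv0 j : 0 <= Lv j by have [/lip3_ge0] := Hv j.
pose L := Lu regime1 + Lu regime2 + Lv regime1 + Lv regime2.
have L0 : 0 <= L by rewrite !addr_ge0.
have uL j : lip3 L (u j).
  have [uj _] := Hu j; apply: lip3_le uj.
  have := (Lu0 regime1, Lu0 regime2, Lv0 regime1, Lv0 regime2).
  by rewrite /L; case: j => -[[[a b] e] f]; lra.
have vL j : lip3 L (v j).
  have [vj _] := Hv j; apply: lip3_le vj.
  have := (Lu0 regime1, Lu0 regime2, Lv0 regime1, Lv0 regime2).
  by rewrite /L; case: j => -[[[a b] e] f]; lra.
have uE j z : Dom T S j z -> u j z = vsub j z by have [_] := Hu j; exact.
have vE j z : Dom T S j z -> v j z = - vsup j z by have [_] := Hv j; exact.
have edge j t s x : Dom T S j (t, s, x) ->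
    [\/ s = 0, s = t, t = T | s = s_bound T S j] -> u j (t, s, x) + v j (t, s, x) <= 0.
  move=> Dz e; rewrite uE// vE// subr_le0; apply: le_boundary.
  exact: Dom_boundary.
have Dom0 j t x : 0 <= t <= T -> Dom T S j (t, 0, x).
  by move=> tT; split => //; rewrite lexx/=; [case: j|case/andP: tT].
have edge0 j t x : 0 <= t <= T -> u j (t, 0, x) + v j (t, 0, x) <= 0.
  by move=> tT; apply: edge; [exact: Dom0|exact: Or41].
have wlip j t s x t' s' x' : u j (t, s, x) + v j (t, s, x) <=
    u j (t', s', x') + v j (t', s', x') + 2 * L * (`|t - t'| + `|s - s'| + `|x - x'|).
  have /ler_normlP[_ h1] := uL j t s x t' s' x'.
  have /ler_normlP[_ h2] := vL j t s x t' s' x'.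
  by move: (u j _) (u j _) (v j _) (v j _) (_ + `|x - x'|) h1 h2; clear=> *; lra.
move=> j z Dz; rewrite -subr_le0 -uE// -vE//.
(* Adding 0 makes [M] nonnegative, hence also a bound for the coupling term, which the boundary
   ordering makes nonpositive. Only the index [j] contributes otherwise. *)
pose A : set R := [set r | r = 0 \/ exists2 y, Dom T S j y & r = u j y + v j y].
have A_ub : has_ubound A.
  (* Each point is joined to [(t, 0, x)], where the difference is at most 0, at a distance
     [s <= T]. *)
  exists (2 * L * T) => _ [->|[[[t s] x] Dy ->]]; first by rewrite !mulr_ge0.
  apply: (le_trans (wlip j t s x t 0 x)); rewrite !subrr normr0 addr0 add0r subr0.
  have [tT /andP[s0 _] /andP[_ st]] := Dy.
  rewrite (le_trans (lerD (edge0 j t x tT) (lexx _)))// add0r ger0_norm//.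
  by rewrite ler_wpM2l ?mulr_ge0// (le_trans st)//; case/andP: tT.
pose M := sup A.
have M0 : 0 <= M by apply: ub_le_sup => //; left.
have leM y : Dom T S j y -> u j y + v j y <= M.
  by move=> Dy; apply: ub_le_sup => //; right; exists y.
pose Emin := expR (- lam * T).
have Emin0 : 0 < Emin by exact: expR_gt0.
have Emin1 : Emin <= 1 by rewrite /Emin -expR0 ler_expR mulNr oppr_le0 mulr_ge0.
suff step y : Dom T S j y -> u j y + v j y <= M - Emin * M.
  suff M_le0 : M <= 0 by exact: le_trans (leM _ Dz) M_le0.
  have : M <= M - Emin * M.
    apply: ge_sup; first by exists 0; left.
    move=> _ [->|[y Dy ->]]; last exact: step.
    by rewrite subr_ge0 ler_piMl.
  by rewrite lerBrDr gerDl pmulr_rle0.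
have MEM : 0 <= M - Emin * M by rewrite subr_ge0 ler_piMl.
case: y => [[t s] x] Dy; have [/andP[t0 tT] /andP[s0 sS] /andP[_ st]] := Dy.
move: s0; rewrite le_eqVlt => /predU1P[s0|s0].
  by apply: le_trans MEM; apply: edge => //; exact: Or41.
move: st; rewrite le_eqVlt => /predU1P[st|st].
  by apply: le_trans MEM; apply: edge => //; exact: Or42.
move: tT; rewrite le_eqVlt => /predU1P[tT|tT].
  by apply: le_trans MEM; apply: edge => //; exact: Or43.
move: sS; rewrite le_eqVlt => /predU1P[sS|sS].
  by apply: le_trans MEM; apply: edge => //; exact: Or44.
have [xi0 [xi0C dxi0]] := premium_primitive R c (m j) T (pi j) (m_ge0 j)
  (pi_measurable j) (pi_ge0 j) (pi_ltc j).
pose C := `|c|; have C0 : 0 <= C by exact: normr_ge0.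
(* The translate whose characteristic passes through the given point at parameter [s]. *)
pose xi r := xi0 r + (x - xi0 s).
have xiC : lip C xi.
  by move=> a b; rewrite /xi (_ : _ - _ = xi0 a - xi0 b); [exact: xi0C|ring].
have dxi : {ae lebesgue_measure, forall r : R, 0 < r < T ->
    is_derive r 1 xi (c - pi j r (m j))}.
  move: dxi0; apply: filterS; first exact: (ae_filter_ringOfSetsType lebesgue_measure).
  move=> r dr /dr {}dr; rewrite -[c - _]addr0; exact: is_deriveD.
pose k := t - s; have k0 : 0 < k by rewrite subr_gt0.
(* Exit parameter of the characteristic: it reaches [t = T] or the upper bound of [s], and never the
   diagonal, since [t - s = k > 0] along it. *)
pose se := Num.min (T - k) (s_bound T S j).
have sse : s < se by rewrite lt_min sS andbT /k; lra.
have end_le0 : u j (k + se, se, xi se) + v j (k + se, se, xi se) <= 0.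
  have [se0 seT seS] : [/\ 0 <= se, se <= T - k & se <= s_bound T S j].
    by rewrite (ltW (lt_trans s0 sse)) /se !ge_min !lexx orbT.
  apply: edge; first by split; lra.
  have [h|h] := leP (T - k) (s_bound T S j).
    by apply: Or43; rewrite /se min_l//; ring.
  by apply: Or44; rewrite /se min_r// ltW.
apply/ler_addgt0Pr => e e0.
(* The growth estimate holds only strictly before the exit, so it is used up to [se - del]. Between
   there and the exit the difference changes by at most [B * del]; the bound [(se - s) / 2] keeps
   the endpoint after [s]. *)
pose B := 2 * L * (2 + C); have B0 : 0 <= B by rewrite /B !mulr_ge0 ?addr_ge0.
pose del := Num.min ((se - s) / 2) (e / (B + 1)).
have B1 : 0 < B + 1 by rewrite ltr_wpDl.
have del0 : 0 < del by rewrite lt_min !divr_gt0 ?subr_gt0.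
have del1 : del <= (se - s) / 2 by rewrite ge_min lexx.
have del2 : B * del <= e.
  apply: (@le_trans _ _ ((B + 1) * (e / (B + 1)))).
    by apply: ler_pM; rewrite ?lerDl ?ge_min ?lexx ?orbT// ltW.
  by rewrite mulrC divfK ?gt_eqF.
pose s1 := se - del.
have ss1 : s < s1 by rewrite /s1; lra.
have s1se : s1 < se by rewrite /s1; lra.
have ks1 : k + s1 < T.
  by rewrite addrC -ltrBrDr (lt_le_trans s1se)// ge_min lexx.
have s1S : s1 < s_bound T S j by rewrite (lt_le_trans s1se)// ge_min lexx orbT.
have le0 t' x' : 0 <= t' <= T -> u regime2 (t', 0, x') + v regime2 (t', 0, x') <= M.
  by move=> tT'; apply: le_trans M0; exact: edge0.
have := characteristic_growth R _ nu2 T S lam c L C m pi vsub vsup u v j xi M l0 M0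
  vsub_sub vsup_super uL vL uE vE leM le0 xiC dxi k s s1 k0 s0 (ltW ss1) ks1 s1S.
have -> : k + s = t by rewrite /k subrK.
have -> : xi s = x by rewrite /xi addrC subrK.
have D1 : Dom T S j (k + s1, s1, xi s1) by split; lra.
have w1 : u j (k + s1, s1, xi s1) + v j (k + s1, s1, xi s1) <= B * del.
  apply: (le_trans (wlip j _ _ _ (k + se) se (xi se))).
  rewrite (le_trans (lerD end_le0 (lexx _)))// add0r /B -[leRHS]mulrA ler_wpM2l ?mulr_ge0//.
  have dE : `|s1 - se| = del by rewrite /s1 addrAC subrr add0r normrN gtr0_norm.
  rewrite (_ : k + s1 - (k + se) = s1 - se); last by ring.
  by have := xiC s1 se; rewrite dE; lra.
have s1T : s1 <= T by lra.
move/(contraction_of_growth R _ _ Emin _ _ M (B * del)) => H.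
apply: (le_trans (H _ _ _ (leM _ Dy) (leM _ D1) w1)).
- by rewrite expR_ge0 -expR0 ler_expR mulNr oppr_le0 mulr_ge0// ltW.
- exact: ltW.
- by rewrite /Emin ler_expR !mulNr lerN2 ler_wpM2l.
- by rewrite lerD2l (le_trans _ del2)// ler_piMl// mulr_ge0// ltW.
Qed.
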